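(* Let $k,\ell$ be positive integers and let $(X,\mathcal{B},\mu)$ be a probability space. For each $i\in\{1,\dots,k\}$ and $j\in\{1,\dots,\ell\}$ let $(T_{i,j}^s)_{s\in\mathbb{R}}:X\to X$ be a continuous ergodic measure preserving $\mathbb{R}$-action and let $p_{i,j}:\mathbb{R}\to\mathbb{R}$ be admissible functions. Assume that all the $T_{i,j}$ commute (in the sense that $T_{i,j}^sT_{\tilde i,\tilde j}^{\tilde s}=T_{\tilde i,\tilde j}^{\tilde s}T_{i,j}^s$ for any $i,\tilde i\in\{1,\dots,k\}$, $j,\tilde j\in\{1,\dots,\ell\}$ and $s,\tilde s\in\mathbb{R}$) and that $\lim_{s\to\infty} p_{i,j}(s)/p_{\tilde i,\tilde j}(s)=0$ whenever $i>\tilde i$ or ($i=\tilde i$ and $j>\tilde j$). Then for any $f_1,\dots,f_k\in L^\infty(X)$ we have $$\lim_{\tau\to\infty}\frac1\tau\int_0^\tau \prod_{i=1}^k\left[\left(\prod_{j=1}^\ell T_{i,j}^{p_{i,j}(s)}\right)f_i\right]ds=\prod_{i=1}^k\int_Xf_i\,d\mu\qquad\text{ in }L^2(X).$$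
   Context: An increasing function $p\in C^2(b,\infty)$ defined on some interval $(b,\infty)$ is called admissible if: (1) the derivative $p'$ is monotone; (2) for every $c\in(0,1)$ there exists $\epsilon\in(0,1)$ such that for all large enough $\tau\in\mathbb{R}$ we have $\epsilon<p(c\tau)/p(\tau)<1-\epsilon$. (Only the values of the $p_{i,j}(s)$ for large $s$ matter; the integral over $[0,\tau]$ is understood as taken over the part of $[0,\tau]$ lying in the intervals $(b,\infty)$ on which the $p_{i,j}$ are admissible.) For a measure preserving map $T$ and a function $f$ on $X$, $Tf=f\circ T$. A measure preserving $\mathbb{R}$-action $(T^s)_{s\in\mathbb{R}}$ is continuous if the induced action on functions is strongly continuous (in $L^1(X)$, equivalently in $L^2(X)$). It is ergodic if any $B\in\mathcal{B}$ with $(T^s)^{-1}(B)=B$ for every $s\in\mathbb{R}$ has $\mu(B)\in\{0,1\}$.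
   Formalization: Ergodicity is taken modulo null sets: any B with μ((T^s)^{-1}(B) Δ B)=0 for every s has μ(B)∈{0,1}; with strictly invariant B only, the claim fails for actions that are not jointly measurable, and for jointly measurable ones the two notions agree. *)

(* Defs.v *)
From HB Require Import structures.
From mathcomp Require Import all_boot all_order all_algebra.
From mathcomp Require Import all_classical all_reals all_analysis measurable_realfun.
From mathcomp Require Import complex.

Set Implicit Arguments.
Unset Strict Implicit.
Unset Printing Implicit Defensive.

Import Order.TTheory GRing.Theory Num.Theory.
Import numFieldNormedType.Exports.

Local Open Scope classical_set_scope.
Local Open Scope ring_scope.

(* Functions on X are complex-valued; elements of L^p are handled through
   representatives. *)

Definition cmeasurable d (X : measurableType d) (R : realType)
    (f : X -> R[i]) : Prop :=
  measurable_fun [set: X] (fun x => complex.Re (f x)) /\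
  measurable_fun [set: X] (fun x => complex.Im (f x)).

Definition cLnorm d (X : measurableType d) (R : realType)
    (mu : probability X R) (p : \bar R) (f : X -> R[i]) : \bar R :=
  Lnorm mu p (fun x => (Normc.normc (f x))%:E).

Definition in_Lp d (X : measurableType d) (R : realType)
    (mu : probability X R) (p : \bar R) (f : X -> R[i]) : Prop :=
  cmeasurable f /\ (cLnorm mu p f < +oo)%E.

Definition cintegral d (X : measurableType d) (R : realType)
    (mu : probability X R) (f : X -> R[i]) : R[i] :=
  Complex (Rintegral mu [set: X] (fun x => complex.Re (f x)))
          (Rintegral mu [set: X] (fun x => complex.Im (f x))).

(* Bochner integral of a function of a real variable with values in
   L^2(X, mu; C). *)

Record L2_simple d (X : measurableType d) (R : realType)
    (mu : probability X R) := L2Simple {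
  ssize : nat;
  sset : 'I_ssize -> set R;
  scoef : 'I_ssize -> X -> R[i];
  sset_measurable : forall m, measurable (sset m);
  sset_finite : forall m, (lebesgue_measure (sset m) < +oo)%E;
  scoef_L2 : forall m, in_Lp mu 2%:E (scoef m) }.

Definition simple_fun d (X : measurableType d) (R : realType)
    (mu : probability X R) (S : L2_simple mu) (s : R) (x : X) : R[i] :=
  \sum_(m < ssize S) ((\1_(sset m) s : R)%:C)%C * scoef m x.

Definition simple_integral d (X : measurableType d) (R : realType)
    (mu : probability X R) (D : set R) (S : L2_simple mu) (x : X) : R[i] :=
  \sum_(m < ssize S)
    ((fine (lebesgue_measure (sset m `&` D)) : R)%:C)%C * scoef m x.

Definition simple_error d (X : measurableType d) (R : realType)
    (mu : probability X R) (F : R -> X -> R[i]) (S : L2_simple mu)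
    (s : R) : \bar R :=
  cLnorm mu 2%:E (fun x => F s x - simple_fun S s x).

(* G is (a representative of) the integral of F over D with respect to
   Lebesgue measure. *)
Definition is_bochner_integral d (X : measurableType d) (R : realType)
    (mu : probability X R) (D : set R) (F : R -> X -> R[i])
    (G : X -> R[i]) : Prop :=
  [/\ (forall s, D s -> in_Lp mu 2%:E (F s)),
      in_Lp mu 2%:E G &
      exists S : nat -> L2_simple mu,
        [/\ (forall n, measurable_fun D (simple_error F (S n))),
            (\int[lebesgue_measure]_(s in D) simple_error F (S n) s)%E
              @[n --> \oo] --> 0%E &
            cLnorm mu 2%:E (fun x => G x - simple_integral D (S n) x)
              @[n --> \oo] --> 0%E]].

Definition measure_preserving d (X : measurableType d) (R : realType)
    (mu : probability X R) (T : X -> X) : Prop :=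
  measurable_fun [set: X] T /\
  forall A, measurable A -> mu (T @^-1` A) = mu A.

Definition measure_preserving_action d (X : measurableType d) (R : realType)
    (mu : probability X R) (T : R -> X -> X) : Prop :=
  [/\ T 0 = id,
      (forall s t, T (s + t) = T s \o T t) &
      (forall s, measure_preserving mu (T s))].

Definition continuous_action d (X : measurableType d) (R : realType)
    (mu : probability X R) (T : R -> X -> X) : Prop :=
  forall f : X -> R[i], in_Lp mu 1%:E f -> forall s0 : R,
    cLnorm mu 1%:E (fun x => f (T s x) - f (T s0 x)) @[s --> s0] --> 0%E.

(* Invariance is understood modulo mu-null sets, as equality of elements of the
   measure algebra.  For jointly measurable actions this is equivalent to asking
   for [T s @^-1` B = B] on the nose, but the action need not be jointly
   measurable here, and an L^1-continuous action can then have only trivial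
   strictly invariant sets although every [T s] is almost everywhere the
   identity. *)
Definition ergodic_action d (X : measurableType d) (R : realType)
    (mu : probability X R) (T : R -> X -> X) : Prop :=
  forall B : set X, measurable B ->
    (forall s, mu ((T s @^-1` B) `+` B) = 0%E) ->
    mu B = 0%E \/ mu B = 1%E.

Definition C2_on_ray (R : realType) (b : R) (p : R -> R) : Prop :=
  forall x, b < x ->
    [/\ derivable p x 1, derivable (derive1 p) x 1 &
        {for x, continuous (derive1 (derive1 p))}].

Definition admissible (R : realType) (b : R) (p : R -> R) : Prop :=
  [/\ C2_on_ray b p,
      (forall x y, b < x -> x < y -> p x < p y),
      (forall x y, b < x -> x <= y -> derive1 p x <= derive1 p y) \/
      (forall x y, b < x -> x <= y -> derive1 p y <= derive1 p x) &
      (forall c : R, 0 < c < 1 -> exists eps : R, 0 < eps < 1 /\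
         \forall tau \near +oo, eps < p (c * tau) / p tau < 1 - eps)].

(* Since T acts on functions by f |-> f o T, a product of operators corresponds
   to the composition in reverse order; this is immaterial for commuting maps. *)
Definition composite_map (X : Type) (R : realType) (l : nat)
    (T : 'I_l -> R -> X -> X) (p : 'I_l -> R -> R) (s : R) : X -> X :=
  \big[(fun g h : X -> X => g \o h)/id]_(j < l) T j (p j s).

Definition integrand (X : Type) (R : realType) (k l : nat)
    (T : 'I_k -> 'I_l -> R -> X -> X) (p : 'I_k -> 'I_l -> R -> R)
    (f : 'I_k -> X -> R[i]) (s : R) (x : X) : R[i] :=
  \prod_(i < k) f i (composite_map (T i) (p i) s x).

(* b i j is the left endpoint of the ray on which p_(i,j) is admissible. *)
Definition admissible_times (R : realType) (k l : nat) (b : 'I_k -> 'I_l -> R)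
    (tau : R) : set R :=
  [set s | 0 <= s <= tau /\ forall i j, b i j < s].

(* Main.v *)
Require Import Defs.
From HB Require Import structures.
From mathcomp Require Import all_boot all_order all_algebra.
From mathcomp Require Import all_classical all_reals all_analysis measurable_realfun.
From mathcomp Require Import complex ess_sup_inf.
From mathcomp Require Import ring lra.
Import Order.TTheory GRing.Theory Num.Theory.
Import numFieldNormedType.Exports.
Local Open Scope classical_set_scope.
Local Open Scope ring_scope.

(** Of all the flows T 0 0 moves fastest, so on a time scale where p 0 0 gains a
    fixed amount the other times p i j hardly change. This lets the first factor
    be averaged on its own, while the later factors stay put: f 0 may be replaced
    by its integral, and then the same argument applies to the product of the remaining factors,
    whose fastest flow is T 1 0, and so on ([moving_prod_average]).

    Averaging one factor. Let v have zero mean, let U be the fast flow and q its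
    time function. By the mean ergodic theorem, in the form that the
    midpoint-convex hull of the translates of v contains elements of arbitrarily
    small norm ([mean_ergodic]), v is approximated by combinations of
    coboundaries v o U^r - v with r > 0. For a coboundary, let sg s be the time at
    which q has gained r since time s, so that q (sg s) = q s + r. The term
    v o U^(q s + r) is, up to o(1), the value at time sg s of the family whose value
    at time s contains v o U^(q s), because the slower times satisfy
    p (sg s) - p s -> 0 ([slow_increment]). Hence the integrand is psi (sg s) - psi s
    up to o(1), where psi is continuous and bounded. As q' is monotone, sg - id is
    monotone, and integrating psi o sg - psi over an interval leaves only boundary
    terms, of size sg tau - tau = o(tau) ([shift_average]). The two properties of
    admissible functions enter through this monotonicity and through the fact
    that s p' s is comparable with p s ([adm_derive_bounds]).

    Weak formulation. The flows need not be jointly measurable in time and space,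
    so integrals in time are taken of the scalar functions s |-> <F s, h> with h in
    L2, which are continuous. All estimates are uniform over h, of the form
    epsilon * tau * |h|; applied to h = G tau / tau - C, whose squared norm is its
    pairing with itself, they give convergence in norm ([bochner_limit]). A Bochner
    integral is determined by such pairings ([bochner_pairing]); it exists because
    step functions approximate the integrand and L2 is complete
    ([bochner_exists]).

    Complex functions are reduced to real bounded ones: each f i is replaced by a
    bounded representative, and the product of the Re f i + i Im f i is expanded
    ([prod_parts]). *)

Set Implicit Arguments.
Unset Strict Implicit.
Unset Printing Implicit Defensive.

(** * The real space L2 of a probability space *)

Section RealL2.
Context d (X : measurableType d) (R : realType) (mu : probability X R).
Implicit Types (f g h : X -> R) (M : R).

Definition L1 f := mu.-integrable [set: X] (EFin \o f).

Definition L2 f := measurable_fun [set: X] f /\ L1 (fun x => f x ^+ 2).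

Definition l2norm f := Num.sqrt (\int[mu]_x (f x ^+ 2)).
Local Notation nrm := l2norm.

Definition bdd M f := measurable_fun [set: X] f /\ forall x, `|f x| <= M.

Lemma L1_le f g : measurable_fun [set: X] f -> L1 g ->
  (forall x, `|f x| <= g x) -> L1 f.
Proof.
move=> mf ig fg; apply: le_integrable ig => //; first exact/measurable_EFinP.
move=> x _ /=; rewrite lee_fin; exact: le_trans (fg x) (ler_norm _).
Qed.

Lemma L1D f g : L1 f -> L1 g -> L1 (fun x => f x + g x).
Proof. exact: integrableD. Qed.

Lemma L1Z a f : L1 f -> L1 (fun x => a * f x).
Proof. by move=> /(integrableZl measurableT a). Qed.

Lemma L1_meas f : L1 f -> measurable_fun [set: X] f.
Proof. by move=> /measurable_int /measurable_EFinP. Qed.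

Lemma L1_cst a : L1 (fun _ => a).
Proof.
exact: finite_measure_integrable_cst.
Qed.

Lemma L1_bdd M f : bdd M f -> L1 f.
Proof. by case=> mf fM; apply: L1_le (L1_cst M) fM. Qed.

Lemma bdd_ge0 M f : bdd M f -> 0 <= M.
Proof. by case=> _ /(_ point) ; apply: le_trans. Qed.

Lemma L2_meas f : L2 f -> measurable_fun [set: X] f. Proof. by case. Qed.

Lemma L2_L1sq f : L2 f -> L1 (fun x => f x ^+ 2). Proof. by case. Qed.

Lemma L2_L1M f g : L2 f -> L2 g -> L1 (fun x => f x * g x).
Proof.
move=> [mf f2] [mg g2]; apply: L1_le (L1D f2 g2) _; first exact: measurable_funM.
move=> x; have := sqr_ge0 (f x - g x); have := sqr_ge0 (f x + g x).
by have := sqr_ge0 (f x); have := sqr_ge0 (g x); rewrite ler_norml; nra.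
Qed.

Lemma L2_cst a : L2 (fun _ => a).
Proof. by split=> //; apply: L1_cst. Qed.

Lemma L2_L1 f : L2 f -> L1 f.
Proof.
by move=> /L2_L1M/(_ (L2_cst 1)); under [X in L1 X]eq_fun do rewrite mulr1.
Qed.

Lemma L2D f g : L2 f -> L2 g -> L2 (fun x => f x + g x).
Proof.
move=> [mf f2] [mg g2]; have mfg := measurable_funD mf mg; split=> //.
apply: (L1_le (g := fun x => 2 * f x ^+ 2 + 2 * g x ^+ 2)).
- exact: measurable_funX.
- by apply: L1D; apply: L1Z.
by move=> x; rewrite ger0_norm ?sqr_ge0//; have := sqr_ge0 (f x - g x); nra.
Qed.

Lemma L2Z a f : L2 f -> L2 (fun x => a * f x).
Proof.
move=> [mf f2]; split; first exact: measurable_funM.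
by under [X in L1 X]eq_fun do rewrite exprMn; apply: L1Z.
Qed.

Lemma L2N f : L2 f -> L2 (fun x => - f x).
Proof. by move=> /(L2Z (-1)); under [X in L2 X]eq_fun do rewrite mulN1r. Qed.

Lemma L2B f g : L2 f -> L2 g -> L2 (fun x => f x - g x).
Proof. by move=> hf /L2N; exact: L2D. Qed.

Lemma L2_sum I (r : seq I) (P : pred I) (F : I -> X -> R) :
  (forall i, P i -> L2 (F i)) -> L2 (fun x => \sum_(i <- r | P i) F i x).
Proof.
move=> h; elim: r => [|a r ih].
  rewrite (_ : (fun x => _) = fun=> 0); first exact: L2_cst.
  by apply/funext => x; rewrite big_nil.
rewrite (_ : (fun x => _) = fun x => if P a then F a x +
  \sum_(j <- r | P j) F j x else \sum_(j <- r | P j) F j x); last first.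
  by apply/funext => x; rewrite big_cons.
by case Pa: (P a) => //; apply: L2D => //; apply: h.
Qed.

Lemma bdd_mul_L2 M f g : bdd M f -> L2 g -> L2 (fun x => f x * g x).
Proof.
move=> [mf fM] [mg g2]; split; first exact: measurable_funM.
apply: (L1_le (g := fun x => M ^+ 2 * g x ^+ 2)).
- by apply: measurable_funX; apply: measurable_funM.
- exact: L1Z.
move=> x; rewrite ger0_norm ?sqr_ge0// exprMn ler_wpM2r ?sqr_ge0//.
by rewrite -(real_normK (num_real (f x))) lerXn2r ?nnegrE// (le_trans _ (fM x)).
Qed.

Lemma bdd_L2 M f : bdd M f -> L2 f.
Proof.
by move=> /bdd_mul_L2/(_ (L2_cst 1)); under [X in L2 X]eq_fun do rewrite mulr1.
Qed.

Lemma nrm_ge0 f : 0 <= nrm f. Proof. exact: sqrtr_ge0. Qed.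

Lemma intsq_ge0 f : 0 <= \int[mu]_x (f x ^+ 2).
Proof. by apply: Rintegral_ge0 => x _; rewrite sqr_ge0. Qed.

Lemma nrm_sqr f : nrm f ^+ 2 = \int[mu]_x (f x ^+ 2).
Proof. by rewrite sqr_sqrtr// intsq_ge0. Qed.

Lemma intD f g : L1 f -> L1 g ->
  \int[mu]_x (f x + g x) = \int[mu]_x f x + \int[mu]_x g x.
Proof. exact: RintegralD. Qed.

Lemma intB f g : L1 f -> L1 g ->
  \int[mu]_x (f x - g x) = \int[mu]_x f x - \int[mu]_x g x.
Proof. exact: RintegralB. Qed.

Lemma intZ a f : L1 f -> \int[mu]_x (a * f x) = a * \int[mu]_x f x.
Proof. exact: RintegralZl. Qed.

Lemma intC a : \int[mu]_x a = a.
Proof.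
rewrite Rintegral_cst//=.
by rewrite probability_setT mulr1.
Qed.

Lemma int_le f g : L1 f -> L1 g -> (forall x, f x <= g x) ->
  \int[mu]_x f x <= \int[mu]_x g x.
Proof. by move=> hf hg fg; apply: le_Rintegral. Qed.

Lemma intsqD f g t : L2 f -> L2 g ->
  \int[mu]_x ((f x + t * g x) ^+ 2) = \int[mu]_x (f x ^+ 2) +
    2 * t * \int[mu]_x (f x * g x) + t ^+ 2 * \int[mu]_x (g x ^+ 2).
Proof.
move=> hf hg; have hfg := L2_L1M hf hg; case: hf hg => [mf f2] [mg g2].
rewrite -intZ// -intZ// -intD//; last exact: L1Z.
rewrite -intD; [|by apply: L1D => //; apply: L1Z|exact: L1Z].
by apply: eq_Rintegral => x _; ring.
Qed.

(** The quadratic polynomial t |-> |f + t g|^2 is nonnegative: test it at its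
    minimum, or, when g has norm 0 and it is affine, at a point where it would be
    -1. *)
Lemma cauchy_schwarz f g : L2 f -> L2 g -> `|\int[mu]_x (f x * g x)| <= nrm f * nrm g.
Proof.
move=> hf hg; rewrite -ler_sqr ?nnegrE ?mulr_ge0 ?nrm_ge0//.
rewrite real_normK ?num_real// exprMn !nrm_sqr.
have key t := intsqD t hf hg.
have {key} : forall t, 0 <= \int[mu]_x (f x ^+ 2) +
    2 * t * \int[mu]_x (f x * g x) + t ^+ 2 * \int[mu]_x (g x ^+ 2).
  by move=> t; rewrite -key intsq_ge0.
move: (intsq_ge0 f) (intsq_ge0 g).
move: (\int[mu]_x (f x ^+ 2)) (\int[mu]_x (g x ^+ 2)) (\int[mu]_x (f x * g x)).
move=> A C B A0 C0 key.
have [C1|C1] := eqVneq C 0; last first.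
  have {}C0 : 0 < C by rewrite lt0r C1.
  have := key (- B / C); rewrite -(pmulr_rge0 _ C0).
  suff -> : C * (A + 2 * (- B / C) * B + (- B / C) ^+ 2 * C) = A * C - B ^+ 2.
    by rewrite subr_ge0.
  by field.
subst C; rewrite mulr0; have [->|B0] := eqVneq B 0; first by rewrite expr0n.
(* Here C = 0 and the polynomial is A + 2 t B: this t gives it the value -1. *)
have := key (- (A + 1) / B / 2); suff -> : A + 2 * (- (A + 1) / B / 2) * B +
  (- (A + 1) / B / 2) ^+ 2 * 0 = -1 by lra.
by field.
Qed.

Lemma nrmD f g : L2 f -> L2 g -> nrm (fun x => f x + g x) <= nrm f + nrm g.
Proof.
move=> hf hg; rewrite -ler_sqr ?nnegrE ?addr_ge0 ?nrm_ge0// nrm_sqr.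
have := intsqD 1 hf hg; under eq_Rintegral do rewrite mul1r; move=> ->.
rewrite -!nrm_sqr; have := le_trans (ler_norm _) (cauchy_schwarz hf hg); lra.
Qed.

Lemma nrm_eq f g : (forall x, f x = g x) -> nrm f = nrm g.
Proof. by move=> /funext ->. Qed.

Lemma nrmZ a f : L2 f -> nrm (fun x => a * f x) = `|a| * nrm f.
Proof.
move=> [mf f2]; rewrite /nrm; under eq_Rintegral do rewrite exprMn.
by rewrite intZ// sqrtrM ?sqr_ge0// sqrtr_sqr.
Qed.

Lemma nrmN f : nrm (fun x => - f x) = nrm f.
Proof. by rewrite /nrm; under eq_Rintegral do rewrite sqrrN. Qed.

Lemma nrmBC f g : nrm (fun x => f x - g x) = nrm (fun x => g x - f x).
Proof. by rewrite -nrmN; apply: nrm_eq => x; rewrite opprB. Qed.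

Lemma nrmB f g : L2 f -> L2 g -> nrm (fun x => f x - g x) <= nrm f + nrm g.
Proof. by move=> hf /[dup] hg /L2N hg'; rewrite -(nrmN g); apply: nrmD. Qed.

Lemma nrm_dist3 f g h : L2 f -> L2 g -> L2 h ->
  nrm (fun x => f x - h x) <= nrm (fun x => f x - g x) + nrm (fun x => g x - h x).
Proof.
move=> hf hg hh; rewrite -[leLHS](nrm_eq (f := fun x => (f x - g x) + (g x - h x))).
  by apply: nrmD; apply: L2B.
by move=> x; rewrite addrA subrK.
Qed.

Lemma nrm_le f g : L2 f -> L2 g -> (forall x, `|f x| <= `|g x|) ->
  nrm f <= nrm g.
Proof.
move=> [_ f2] [_ g2] fg; rewrite ler_wsqrtr// int_le// => x.
by rewrite -(real_normK (num_real (f x))) -(real_normK (num_real (g x))) lerXn2r ?nnegrE.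
Qed.

Lemma nrm_mulbdd M f g : bdd M f -> L2 g -> nrm (fun x => f x * g x) <= M * nrm g.
Proof.
move=> hf hg; have M0 := bdd_ge0 hf.
rewrite -(ger0_norm M0) -nrmZ// nrm_le//; first exact: bdd_mul_L2 hf hg.
- exact: L2Z.
by move=> x; rewrite !normrM ler_wpM2r// (ger0_norm M0); case: hf.
Qed.

Lemma nrm_bdd M f : bdd M f -> nrm f <= M.
Proof.
move=> hf; have := nrm_mulbdd hf (L2_cst 1).
by rewrite /nrm expr1n intC sqrtr1 mulr1; under eq_Rintegral do rewrite mulr1.
Qed.

Lemma int_le_nrm f : L2 f -> `|\int[mu]_x f x| <= nrm f.
Proof.
move=> hf; have := cauchy_schwarz hf (L2_cst 1); rewrite {2}/nrm expr1n intC sqrtr1 mulr1.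
by under eq_Rintegral do rewrite mulr1.
Qed.

(** This is how continuity of the flows in L1 becomes continuity in L2. *)
Lemma nrm_sq_bdd M f : bdd M f -> nrm f ^+ 2 <= M * \int[mu]_x `|f x|.
Proof.
move=> hf; have [mf fM] := hf; rewrite nrm_sqr.
have i1 : L1 (fun x => `|f x|) by apply: integrable_norm; apply: L1_bdd hf.
rewrite -intZ//; apply: int_le; [by case: (bdd_L2 hf)|exact: L1Z|].
by move=> x; rewrite -(real_normK (num_real (f x))) expr2 ler_wpM2r.
Qed.

Lemma bddB M N f g : bdd M f -> bdd N g -> bdd (M + N) (fun x => f x - g x).
Proof.
move=> [mf fM] [mg gN]; split; first exact: measurable_funB.
by move=> x; apply: le_trans (ler_normB _ _) (lerD (fM x) (gN x)).
Qed.

Lemma bddD M N f g : bdd M f -> bdd N g -> bdd (M + N) (fun x => f x + g x).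
Proof.
move=> [mf fM] [mg gN]; split; first exact: measurable_funD.
by move=> x; apply: le_trans (ler_normD _ _) (lerD (fM x) (gN x)).
Qed.

Lemma bddZ M a f : bdd M f -> bdd (`|a| * M) (fun x => a * f x).
Proof.
move=> [mf fM]; split; first exact: measurable_funM.
by move=> x; rewrite normrM ler_wpM2l.
Qed.

Lemma bddM M N f g : bdd M f -> bdd N g -> bdd (M * N) (fun x => f x * g x).
Proof.
move=> hf hg; have [mf fM] := hf; have [mg gN] := hg; split; first exact: measurable_funM.
by move=> x; rewrite normrM ler_pM.
Qed.

Lemma bdd_cst a : bdd `|a| (fun _ => a). Proof. by split. Qed.

Lemma bdd_le M N f : M <= N -> bdd M f -> bdd N f.
Proof. by move=> MN [mf fM]; split=> // x; apply: le_trans MN. Qed.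

Section Preserving.
Variables (T : X -> X) (hT : measure_preserving mu T).

Lemma mp_meas f : measurable_fun [set: X] f -> measurable_fun [set: X] (f \o T).
Proof. by move=> mf; apply: measurableT_comp mf _; case: hT. Qed.

Lemma mp_integral (f : X -> \bar R) : measurable_fun [set: X] f ->
  (forall x, 0 <= f x)%E ->
  (\int[mu]_x f (T x) = \int[mu]_x f x)%E.
Proof.
move=> mf f0; have mT : measurable_fun [set: X] T by case: hT.
have := ge0_integral_pushforward mT mu measurableT mf (fun x _ => f0 x).
rewrite preimage_setT => <-.
by apply: eq_measure_integral => A mA _; rewrite /pushforward; case: hT => _ hm; exact: hm.
Qed.

Lemma mp_L1 f : L1 f -> L1 (f \o T).
Proof.
move=> /integrableP[mf hf]; apply/integrableP; split.
  exact/measurable_EFinP/mp_meas/measurable_EFinP.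
rewrite (mp_integral (f := fun x => `|(f x)%:E|%E))//.
exact: (measurableT_comp _ mf).
Qed.

Lemma mp_int f : L1 f -> \int[mu]_x f (T x) = \int[mu]_x f x.
Proof.
move=> hf; have mT : measurable_fun [set: X] T by case: hT.
rewrite /Rintegral; congr fine.
have mf := measurable_int _ hf.
have i1 : mu.-integrable (T @^-1` [set: X]) ((EFin \o f) \o T).
  by rewrite preimage_setT; apply: mp_L1 hf.
have := integral_pushforward mT mf i1 measurableT.
rewrite preimage_setT => <-.
by apply: eq_measure_integral => A mA _; rewrite /pushforward; case: hT => _ hm; exact: hm.
Qed.

Lemma mp_L2 f : L2 f -> L2 (f \o T).
Proof. by move=> [mf f2]; split; [exact: mp_meas|exact: mp_L1 f2]. Qed.

Lemma mp_nrm f : L2 f -> nrm (f \o T) = nrm f.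
Proof. by move=> [mf f2]; rewrite /nrm -(mp_int f2). Qed.

Lemma mp_nrm_dist f g : L2 f -> L2 g ->
  nrm (fun x => f (T x) - g (T x)) = nrm (fun x => f x - g x).
Proof. by move=> hf hg; rewrite -[RHS]mp_nrm//; apply: L2B. Qed.

Lemma mp_bdd M f : bdd M f -> bdd M (f \o T).
Proof. by move=> [mf fM]; split; [exact: mp_meas|move=> x; exact: fM]. Qed.

End Preserving.

Lemma mp_comp (T T' : X -> X) : measure_preserving mu T ->
  measure_preserving mu T' -> measure_preserving mu (T \o T').
Proof.
move=> [mT hT] [mT' hT']; split; first exact: measurableT_comp mT mT'.
move=> A mA; rewrite comp_preimage hT' ?hT//.
by rewrite -[_ @^-1` _]setTI; apply: mT.
Qed.

Lemma mp_id : measure_preserving mu id.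
Proof. by split. Qed.

End RealL2.

(** * Completeness *)

Section Completeness.
Context d (X : measurableType d) (R : realType) (mu : probability X R).
Local Notation nrm := (l2norm mu).
Local Notation L2 := (L2 mu).

Lemma L1_EFin (f : X -> R) : measurable_fun [set: X] f -> L1 mu f ->
  (\int[mu]_x (f x)%:E = (\int[mu]_x f x)%R%:E)%E.
Proof. by move=> mf hf; rewrite fineK//; apply: integrable_fin_num. Qed.

(** The sum of the |v (k+1) - v k| has finite integral, hence is finite almost
    everywhere, and where it is finite the sequence converges. *)
Lemma ae_cvg_summable (v : nat -> X -> R) : (forall k, L2 (v k)) ->
  (forall k, nrm (fun x => v k.+1 x - v k x) <= 2^-1 ^+ k) ->
  exists E : set X, [/\ measurable E, mu (~` E) = 0%E &
    forall x, E x -> cvgn (v ^~ x)].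
Proof.
move=> hv hd; pose D k x : R := `|v k.+1 x - v k x|.
have D0 k x : (0 <= (D k x)%:E)%E by rewrite lee_fin /D.
have mD k : measurable_fun [set: X] (EFin \o D k).
  by apply/measurable_EFinP/measurableT_comp => //; case: (L2B (hv k.+1) (hv k)).
have iD k : (\int[mu]_x (D k x)%:E <= (2^-1 ^+ k)%:E)%E.
  have i1 : L1 mu (D k).
    by apply: integrable_norm; apply: L2_L1; exact: L2B.
  rewrite L1_EFin//; last exact: L1_meas i1.
  rewrite lee_fin; apply: le_trans (hd k).
  have i2 : L2 (D k).
    split; first exact: L1_meas i1.
    rewrite (_ : (fun x => _) = fun x => (v k.+1 x - v k x) ^+ 2).
      by apply: L2_L1sq; exact: L2B.
    by apply/funext => x; rewrite real_normK ?num_real.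
  apply: le_trans (ler_norm _) _; apply: le_trans (int_le_nrm i2) _.
  by apply: nrm_le => //; [exact: L2B|move=> x; rewrite normr_id].
pose S x : \bar R := (\sum_(k <oo) (D k x)%:E)%E.
have mS : measurable_fun [set: X] S.
  by apply: ge0_emeasurable_sum => [k x _ _|k _]; [exact: D0|exact: mD].
have S0 x : (0 <= S x)%E by apply: nneseries_ge0 => k _ _; exact: D0.
have iS : (\int[mu]_x S x < +oo)%E.
  rewrite integral_nneseries//.
  apply: le_lt_trans (_ : (\sum_(k <oo) (2^-1 ^+ k : R)%:E < +oo)%E); last first.
    have := @cvg_geometric_eseries_half R 2 0.
    have -> : eseries (fun k => (2 / (2 ^ (k + 1))%:R)%:E : \bar R) =
              eseries (fun k => (2^-1 ^+ k)%:E).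
      congr eseries; apply/funext => k; rewrite natrX addn1 exprS.
      by rewrite invfM mulrA divff// mul1r exprVn.
    by move=> /cvg_lim; rewrite expr0 divr1 => -> //; rewrite ltry.
  apply: lee_nneseries => k _; last exact: iD.
  by move=> _; apply: integral_ge0 => x _; exact: D0.
pose E := [set: X] `&` [set x | (S x < +oo)%E].
have mE : measurable E by apply: emeasurable_fun_infty_o.
exists E; split => //.
  have /integrable_ae -/(_ measurableT) : mu.-integrable [set: X] S.
    apply/integrableP; split => //.
    by under eq_integral do rewrite gee0_abs//.
  move=> /= aeS.
  apply/negligibleP; first exact: measurableC.
  apply: negligibleS aeS => x; rewrite /E setTI /= => h1 h2.
  by apply: h1; have := h2 I; rewrite ge0_fin_numE.
move=> x; rewrite /E setTI /= => Sx.
have : cvgn (series (telescope (v ^~ x))).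
  apply: normed_cvg; apply: nondecreasing_is_cvgn.
    by apply: nondecreasing_series => n _ _; exact: normr_ge0.
  exists (fine (S x)) => _ [n _ <-].
  rewrite -lee_fin fineK ?ge0_fin_numE//.
  rewrite /series/= -sumEFin; apply: nneseries_lim_ge => k _ _.
  exact: D0.
move=> hc; rewrite (_ : v ^~ x = fun n => v 0%N x + series (telescope (v ^~ x)) n).
  by apply: is_cvgD => //; apply: is_cvg_cst.
by apply/funext => n; rewrite -eq_sum_telescope.
Qed.

(** Fatou's lemma for squares. It identifies the pointwise limit of a
    subsequence with its limit in norm. *)
Lemma nrm_fatou (f : nat -> X -> R) (g : X -> R) e :
  (forall k, L2 (f k)) -> (forall x, f ^~ x @ \oo --> g x) ->
  (\forall k \near \oo, nrm (f k) <= e) -> L2 g /\ nrm g <= e.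
Proof.
move=> hf fg fe.
have e0 : 0 <= e.
  by case: fe => N _ /(_ N (leqnn N)); apply: le_trans; exact: nrm_ge0.
have mg : measurable_fun [set: X] g.
  by apply: (measurable_fun_cvg (h := f)) => [k|x _]; [case: (hf k)|exact: fg].
have mf2 k : measurable_fun [set: X] (fun x => (f k x ^+ 2)%:E).
  by apply/measurable_EFinP/measurable_funX; case: (hf k).
have f20 k x : [set: X] x -> (0 <= (f k x ^+ 2)%:E)%E by rewrite lee_fin sqr_ge0.
have := fatou mu measurableT mf2 f20.
have -> : (\int[mu]_x limn_einf ((fun k x => (f k x ^+ 2)%:E)^~ x) =
           \int[mu]_x (g x ^+ 2)%:E)%E.
  apply: eq_integral => x _.
  have : (fun k => (f k x ^+ 2)%:E) @ \oo --> (g x ^+ 2)%:E.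
    by apply: cvg_EFin; [exact: nearW|under eq_fun do rewrite expr2; rewrite expr2; apply: cvgM; exact: fg].
  by move=> /cvg_limn_einf_sup[].
have h1 : (limn_einf (fun k => \int[mu]_x (f k x ^+ 2)%:E) <= (e ^+ 2)%:E)%E.
  rewrite limn_einf_lim; apply: lime_le; first exact: is_cvg_einfs.
  case: fe => N _ fe; exists N => // n /= Nn.
  apply: le_trans (_ : (\int[mu]_x (f n x ^+ 2)%:E <= _)%E).
    by apply: ereal_inf_lbound; exists n => //=.
  rewrite L1_EFin; [|by apply: measurable_funX; case: (hf n)|by case: (hf n)].
  rewrite lee_fin -nrm_sqr lerXn2r ?nnegrE ?nrm_ge0//.
  by apply: fe.
move=> h2; have {h1 h2} h := le_trans h2 h1.
have ig : L1 mu (fun x => g x ^+ 2).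
  apply/integrableP; split; first exact/measurable_EFinP/measurable_funX.
  rewrite (eq_integral (fun x => (g x ^+ 2)%:E)); first exact: le_lt_trans h (ltry _).
  by move=> x _ /=; rewrite ger0_norm ?sqr_ge0.
split => //; rewrite -ler_sqr ?nnegrE ?nrm_ge0// nrm_sqr -lee_fin -L1_EFin//.
exact: measurable_funX.
Qed.

(** Riesz-Fischer. A subsequence with increments at most 2^-k converges almost
    everywhere; Fatou's lemma turns the Cauchy property into convergence in norm
    to the limit obtained. *)
Lemma L2_complete (u : nat -> X -> R) : (forall n, L2 (u n)) ->
  (forall e, 0 < e -> exists N, forall n m, (N <= n)%N -> (N <= m)%N ->
     nrm (fun x => u n x - u m x) <= e) ->
  exists w, L2 w /\ forall e, 0 < e -> exists N, forall n, (N <= n)%N ->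
     nrm (fun x => u n x - w x) <= e.
Proof.
move=> hu hC.
have /choice[phi hphi] k : exists N, forall n m, (N <= n)%N -> (N <= m)%N ->
     nrm (fun x => u n x - u m x) <= 2^-1 ^+ k.
  by apply: hC; rewrite exprn_gt0// invr_gt0.
pose nk k := (\sum_(j < k.+1) phi j + k)%N.
have nkge k : (phi k <= nk k)%N.
  by rewrite /nk big_ord_recr/= -addnA addnCA leq_addr.
have nkS k : (nk k <= nk k.+1)%N.
  by rewrite /nk [in leqRHS]big_ord_recr/= -addnA leq_add2l addnS ltnW// ltnS leq_addl.
have nkk k : (k <= nk k)%N by rewrite /nk leq_addl.
pose v k := u (nk k).
have [||E [mE E0 cE]] := @ae_cvg_summable v; first by move=> k; exact: hu.
  by move=> k; apply: hphi; [exact: leq_trans (nkge k) (nkS k)|exact: nkge].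
have aeE : (\forall x \ae mu, E x).
  by apply/negligibleP => //; exact: measurableC.
(* Multiplying by the indicator of E makes the sequence converge everywhere, so
   that its limit is measurable. *)
pose v' k x := \1_E x * v k x.
have bE : bdd 1 (\1_E : X -> R).
  by split=> // x; rewrite indicE; case: (_ \in _); rewrite ?normr1 ?normr0.
have hv' k : L2 (v' k) by apply: bdd_mul_L2 bE (hu _).
pose w x := limn (v' ^~ x).
have cw x : v' ^~ x @ \oo --> w x.
  have [Ex|Ex] := pselect (E x).
    rewrite /w /v' indicE mem_set//; under eq_fun do rewrite mul1r.
    exact: cE.
  rewrite /w /v' indicE memNset//; under eq_fun do rewrite mul0r.
  by rewrite lim_cst//; exact: cvg_cst.
have key e : 0 < e -> exists N, forall n, (N <= n)%N ->
    L2 (fun x => u n x - w x) /\ nrm (fun x => u n x - w x) <= e.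
  move=> /hC[N hN]; exists N => n Nn.
  apply: (nrm_fatou (f := fun k x => u n x - v' k x)).
  - by move=> k; apply: L2B.
  - by move=> x; apply: cvgB; [exact: cvg_cst|exact: cw].
  exists N => // k /= Nk.
  rewrite (_ : nrm _ = nrm (fun x => u n x - v k x)).
    by apply: hN => //; exact: leq_trans Nk (nkk k).
  rewrite /nrm /Rintegral; congr (Num.sqrt (fine _)).
  apply: ae_eq_integral => //.
  - by apply/measurable_EFinP/measurable_funX; case: (L2B (hu n) (hv' k)).
  - by apply/measurable_EFinP/measurable_funX; case: (L2B (hu n) (hu (nk k))).
  apply: filterS aeE => x Ex _; rewrite /v' indicE mem_set// mul1r//.
exists w; split.
  have [N /(_ N (leqnn N))[h _]] := key 1 ltr01.
  rewrite (_ : w = fun x => u N x - (u N x - w x)); first exact: L2B.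
  by apply/funext => x; rewrite subKr.
by move=> e /key[N hN]; exists N => n /hN[].
Qed.

End Completeness.

(** * The mean ergodic theorem for one flow *)

Section MeanErgodic.
Context d (X : measurableType d) (R : realType) (mu : probability X R).
Local Notation nrm := (l2norm mu).
Local Notation L2 := (L2 mu).
Local Notation L1 := (L1 mu).

Lemma int_ae (f g : X -> R) : measurable_fun [set: X] f ->
  measurable_fun [set: X] g -> (\forall x \ae mu, f x = g x) ->
  \int[mu]_x f x = \int[mu]_x g x.
Proof.
move=> mf mg fg; rewrite /Rintegral; congr fine.
apply: ae_eq_integral => //; try exact/measurable_EFinP.
by apply: filterS fg => x -> _.
Qed.

Lemma nrm_ae (f g : X -> R) : measurable_fun [set: X] f ->
  measurable_fun [set: X] g -> (\forall x \ae mu, f x = g x) ->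
  nrm f = nrm g.
Proof.
move=> mf mg fg; rewrite /nrm (int_ae (g := fun x => g x ^+ 2))//.
- exact: measurable_funX.
- exact: measurable_funX.
by apply: filterS fg => x ->.
Qed.

Lemma int_abs0_ae (f : X -> R) : L1 f -> \int[mu]_x `|f x| = 0 ->
  \forall x \ae mu, f x = 0.
Proof.
move=> hf f0; have mf : measurable_fun [set: X] (EFin \o f).
  exact: measurable_int hf.
have /(ae_eq_integral_abs _ measurableT mf) : (\int[mu]_x `|(EFin \o f) x| = 0)%E.
  have <- : (\int[mu]_x (`|f x|)%:E)%E = 0%E :> \bar R.
    rewrite L1_EFin ?f0//; last exact: integrable_norm.
    by apply: measurableT_comp => //; exact: L1_meas hf.
  by [].
by apply: filterS => x /(_ I) [].
Qed.

Lemma nrm0_ae (f : X -> R) : L2 f -> nrm f = 0 -> \forall x \ae mu, f x = 0.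
Proof.
move=> hf f0; have := nrm_sqr mu f; rewrite f0 expr0n/= => h.
have /int_abs0_ae : L1 (fun x => f x ^+ 2) by case: hf.
have -> : \int[mu]_x `|f x ^+ 2| = 0.
  by rewrite [RHS]h; apply: eq_Rintegral => x _; rewrite ger0_norm ?sqr_ge0.
by move=> /(_ erefl); apply: filterS => x /eqP; rewrite sqrf_eq0 => /eqP.
Qed.

Section Action.
Variables (U : R -> X -> X) (hU : measure_preserving_action mu U).

Lemma act_add s t x : U (s + t) x = U s (U t x).
Proof. by case: hU => _ -> _. Qed.

Lemma act_mp s : measure_preserving mu (U s). Proof. by case: hU. Qed.

Lemma act0 x : U 0 x = x. Proof. by case: hU => ->. Qed.

Hypothesis eU : ergodic_action mu U.

(** A single level set suffices: {w < 0} is invariant modulo null sets, so by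
    ergodicity w has constant sign almost everywhere, and a function of constant
    sign with zero integral is null. *)
Lemma invariant_null (w : X -> R) : L2 w -> \int[mu]_x w x = 0 ->
  (forall r, 0 < r -> nrm (fun x => w (U r x) - w x) = 0) -> nrm w = 0.
Proof.
move=> hw w0 winv; have mw := L2_meas hw.
pose B := [set x | w x < 0].
have mB : measurable B.
  rewrite (_ : B = [set: X] `&` w @^-1` `]-oo, 0[); first exact: mw.
  by apply/seteqP; split => x; rewrite /B setTI /= in_itv.
have mUB r : measurable (U r @^-1` B).
  by rewrite -[_ @^-1` _]setTI; case: (act_mp r) => h _; apply: h.
have pos r : 0 < r -> mu ((U r @^-1` B) `+` B) = 0%E.
  move=> r0; apply/negligibleP.
    by apply: measurableU; apply: measurableD.
  have /nrm0_ae -/(_ (winv r r0)) : L2 (fun x => w (U r x) - w x).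
    by apply: L2B => //; exact: (mp_L2 (act_mp r) hw).
  apply: negligibleS => x /= h e; move/eqP : e; rewrite subr_eq0 => /eqP e.
  by case: h => -[]; rewrite /B/= e.
(* For r < 0 the symmetric difference is the preimage under U r of the one
   for - r. *)
have all r : mu ((U r @^-1` B) `+` B) = 0%E.
  have [r0|r0|->] := ltgtP r 0; last 2 first.
  - exact: pos.
  - rewrite (_ : _ `+` _ = set0) ?measure0//.
    by apply/seteqP; split => // x; rewrite /B/= => -[] []; rewrite act0.
  have := pos (- r); rewrite oppr_gt0 => /(_ r0).
  case: (act_mp r) => _ <-; last by apply: measurableU; apply: measurableD.
  have E : U r @^-1` (U (- r) @^-1` B) = B.
    by apply/seteqP; split => x /=; rewrite -act_add addNr act0.
  have -> : U r @^-1` (U (- r) @^-1` B `+` B) =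
    (U r @^-1` (U (- r) @^-1` B)) `+` (U r @^-1` B) by [].
  by rewrite E setYC.
have [c aec] : exists c : R, \forall x \ae mu, `|w x| = c * w x.
  have [B0|B1] := eU mB all.
    exists 1; move/negligibleP : B0 => /(_ mB); apply: negligibleS => x /= h.
    by rewrite /B/= ltNge; apply/negP => /ger0_norm; rewrite mul1r in h *.
  exists (-1).
  have : mu (~` B) = 0%E by rewrite probability_setC// B1 subee.
  move/negligibleP => /(_ (measurableC mB)); apply: negligibleS => x /= h.
  by rewrite /B/= => /ltr0_norm; rewrite mulN1r in h *.
have i1 := L2_L1 hw.
have /(int_abs0_ae i1) ae0 : \int[mu]_x `|w x| = 0.
  rewrite (int_ae _ _ aec) ?intZ ?w0 ?mulr0//.
  - exact: measurableT_comp.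
  - exact: measurable_funM.
by rewrite (nrm_ae _ _ ae0)// /nrm expr0n/= intC sqrtr0.
Qed.

(** Closure under midpoints replaces convexity: it is what the parallelogram law
    uses, and it makes properties of the hull provable by induction. *)
Inductive hull (v : X -> R) : (X -> R) -> Prop :=
| hull_gen r : 0 < r -> hull v (fun x => v (U r x))
| hull_mid f g : hull v f -> hull v g -> hull v (fun x => 2^-1 * (f x + g x)).

Lemma hull_bdd M v f : bdd M v -> hull v f -> bdd M f.
Proof.
move=> hv; elim => [r r0|{}f g _ hf _ hg]; first exact: (mp_bdd (act_mp r) hv).
apply: bdd_le (bddZ 2^-1 (bddD hf hg)).
by rewrite ger0_norm ?invr_ge0//; lra.
Qed.

Lemma hull_int M v f : bdd M v -> \int[mu]_x v x = 0 -> hull v f ->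
  \int[mu]_x f x = 0.
Proof.
move=> hv v0; elim => [r r0|{}f g hf f0 hg g0].
  by rewrite (mp_int (act_mp r) (L1_bdd mu hv)).
have i1 := L1_bdd mu (hull_bdd hv hf); have i2 := L1_bdd mu (hull_bdd hv hg).
by rewrite intZ ?intD ?f0 ?g0 ?addr0 ?mulr0//; exact: L1D.
Qed.

Lemma hull_shift v f r : 0 < r -> hull v f -> hull v (fun x => f (U r x)).
Proof.
move=> r0; elim => [s s0|{}f g _ hf _ hg]; last exact: hull_mid.
rewrite (_ : (fun x => _) = fun x => v (U (s + r) x)).
  by apply: hull_gen; exact: addr_gt0.
by apply/funext => x; rewrite act_add.
Qed.

(** The parallelogram law, arranged to show that two elements of nearly minimal
    norm of a set closed under midpoints are close to each other. *)
Lemma intsq_mid f g : L2 f -> L2 g ->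
  nrm (fun x => f x - g x) ^+ 2 = 2 * nrm f ^+ 2 + 2 * nrm g ^+ 2
    - 4 * nrm (fun x => 2^-1 * (f x + g x)) ^+ 2.
Proof.
move=> hf hg; rewrite nrmZ; last exact: L2D.
rewrite ger0_norm ?invr_ge0// exprMn !nrm_sqr.
have e1 := intsqD 1 hf hg; have e2 := intsqD (-1) hf hg.
rewrite (_ : \int[mu]_x (f x - g x) ^+ 2 = \int[mu]_x (f x + -1 * g x) ^+ 2); last first.
  by apply: eq_Rintegral => x _; rewrite mulN1r.
rewrite (_ : \int[mu]_x (f x + g x) ^+ 2 = \int[mu]_x (f x + 1 * g x) ^+ 2); last first.
  by apply: eq_Rintegral => x _; rewrite mul1r.
by rewrite e1 e2; lra.
Qed.

(** A sequence minimizing the norm over the hull is Cauchy by the parallelogram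
    law. Translating it by U r keeps it minimizing, so its limit is invariant,
    and therefore null since its integral is 0: the infimum of the norms is 0. *)
Lemma mean_ergodic M v : bdd M v -> \int[mu]_x v x = 0 ->
  forall e, 0 < e -> exists2 f, hull v f & nrm f <= e.
Proof.
move=> hv v0; pose S := [set nrm f ^+ 2 | f in hull v].
have S0 : S !=set0 by exists (nrm (fun x => v (U 1 x)) ^+ 2); eexists => //; exact: hull_gen.
have lS : has_lbound S by exists 0 => _ [f _ <-]; exact: sqr_ge0.
pose m := inf S.
have hm f : hull v f -> m <= nrm f ^+ 2 by move=> hf; apply: ge_inf => //; exists f.
have /choice[u hu] n : exists f, hull v f /\ nrm f ^+ 2 <= m + n.+1%:R^-1.
  have [//|_ [f hf <-] /ltW h] := @inf_adherent _ S n.+1%:R^-1 _ (conj S0 lS).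
  by exists f.
have L2h f : hull v f -> L2 f by move=> /(hull_bdd hv) /(@bdd_L2 _ _ _ mu).
have L2u n : L2 (u n) by apply: L2h; case: (hu n).
have close f n : hull v f -> nrm f ^+ 2 <= m + n.+1%:R^-1 -> forall k, (n <= k)%N ->
    nrm (fun x => f x - u k x) ^+ 2 <= 4 * n.+1%:R^-1.
  move=> hf fn k nk; have [huk uk] := hu k.
  rewrite (intsq_mid (L2h _ hf) (L2h _ huk)).
  have := hm _ (hull_mid hf huk).
  have : (k.+1%:R^-1 : R) <= n.+1%:R^-1 by rewrite lef_pV2 ?posrE// ler_nat.
  move: fn uk; move: (n.+1%:R^-1) (k.+1%:R^-1) (nrm f) (nrm (u k)) (nrm _).
  by move=> a b A B C; lra.
have small e : 0 < e -> exists n : nat, (4 : R) * n.+1%:R^-1 <= e.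
  move=> e0; exists (Num.truncn (4 / e)).
  rewrite ler_pdivrMr// -ler_pdivrMl// mulrC ltW//.
  by rewrite truncnS_gt.
have [e e0|w [hw cw]] := L2_complete L2u.
  have [N hN] := small (e ^+ 2) (exprn_gt0 _ e0).
  exists N => n k Nn Nk; rewrite -ler_sqr ?nnegrE ?nrm_ge0 ?(ltW e0)//.
  wlog nk : n k Nn Nk / (n <= k)%N.
    move=> H; have [nk|/ltnW nk] := leqP n k; first exact: H.
    by rewrite nrmBC; exact: H.
  have [h1 h2] := hu n; apply: le_trans (close _ n h1 h2 k nk) _.
  apply: le_trans hN; rewrite ler_pM2l// lef_pV2 ?posrE// ler_nat//.
have cw2 : forall f n, hull v f -> nrm f ^+ 2 <= m + n.+1%:R^-1 ->
    nrm (fun x => f x - w x) ^+ 2 <= 16 * n.+1%:R^-1.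
  move=> f n hf fn; have [|N hN] := cw (Num.sqrt (4 * n.+1%:R^-1)).
    by rewrite sqrtr_gt0 mulr_gt0.
  pose k := maxn n N.
  have h1 := close _ _ hf fn k (leq_maxl _ _).
  have h2 := hN k (leq_maxr _ _).
  have h3 := nrm_dist3 (L2h _ hf) (L2u k) hw.
  have s2 : Num.sqrt (4 * n.+1%:R^-1 : R) ^+ 2 = 4 * n.+1%:R^-1.
    by rewrite sqr_sqrtr// mulr_ge0// invr_ge0.
  have {}h1 : nrm (fun x => f x - u k x) <= Num.sqrt (4 * n.+1%:R^-1).
    by rewrite -ler_sqr ?nnegrE ?sqrtr_ge0 ?nrm_ge0// s2.
  have n0 := nrm_ge0 mu (fun x => f x - w x).
  rewrite (_ : 16 * _ = (2 * Num.sqrt (4 * n.+1%:R^-1)) ^+ 2); last first.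
    by rewrite exprMn s2 mulrA; congr (_ * _); lra.
  rewrite lerXn2r ?nnegrE ?mulr_ge0 ?sqrtr_ge0//.
  by apply: le_trans h3 _; rewrite [leRHS]mulrDl mul1r lerD.
have winv r : 0 < r -> nrm (fun x => w (U r x) - w x) = 0.
  move=> r0; apply/eqP; rewrite eq_le nrm_ge0 andbT; apply/ler_addgt0Pl => e e0.
  rewrite addr0.
  have e4 : 0 < (e / 4) ^+ 2 by rewrite exprn_gt0// divr_gt0.
  have [n hn] := small _ e4.
  have [h1 h2] := hu n.
  have h3 := hull_shift r0 h1.
  have h4 := cw2 _ _ h1 h2.
  have h5 := cw2 _ n h3; rewrite (mp_nrm (act_mp r) (L2u n)) in h5.
  have {}h5 := h5 h2.
  have L2wr := mp_L2 (act_mp r) hw.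
  have e1 : nrm (fun x => w (U r x) - u n (U r x)) = nrm (fun x => u n x - w x).
    by rewrite nrmBC; exact: (mp_nrm_dist (act_mp r) (L2u n) hw).
  have h6 : nrm (fun x => w (U r x) - w x) <=
      nrm (fun x => u n x - w x) + nrm (fun x => u n (U r x) - w x).
    by rewrite -e1; exact: (nrm_dist3 L2wr (L2h _ h3) hw).
  have n1 := nrm_ge0 mu (fun x => u n x - w x).
  have n2 := nrm_ge0 mu (fun x => u n (U r x) - w x).
  apply: le_trans h6 _; rewrite [leRHS](splitr e) lerD//.
    rewrite -ler_sqr ?nnegrE ?divr_ge0 ?(ltW e0)//.
    by apply: le_trans h4 _; move: hn; move: (n.+1%:R^-1) => a; lra.
  rewrite -ler_sqr ?nnegrE ?divr_ge0 ?(ltW e0)//.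
  by apply: le_trans h5 _; move: hn; move: (n.+1%:R^-1) => a; lra.
have w0 : \int[mu]_x w x = 0.
  apply/eqP; rewrite -normr_eq0 eq_le normr_ge0 andbT; apply/ler_addgt0Pl => e e0.
  rewrite addr0; have [N /(_ N (leqnn N)) hN] := cw _ e0.
  have [h1 _] := hu N; have := int_le_nrm (L2B (L2u N) hw).
  rewrite intB; [|exact: L2_L1|exact: L2_L1].
  by rewrite (hull_int hv v0 h1) sub0r normrN => /le_trans; apply.
have nw := invariant_null hw w0 winv.
move=> e e0; have [N /(_ N (leqnn N)) hN] := cw _ e0.
exists (u N); first by case: (hu N).
have := nrmD (L2B (L2u N) hw) hw; rewrite nw addr0 => h.
rewrite -(nrm_eq mu (f := fun x => u N x - w x + w x)).
  exact: le_trans hN.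
by move=> x; rewrite subrK.
Qed.

End Action.
End MeanErgodic.

(** * Admissible functions *)

Section RealLine.
Context (R : realType).
Implicit Types (b r A M : R) (p q f : R -> R).

Lemma mvt_ray A f df : (forall x, A < x -> is_derive x (1:R) f (df x)) ->
  forall a c, A < a -> a < c ->
  exists2 x, a < x < c & f c - f a = df x * (c - a).
Proof.
move=> hf a c Aa ac.
have [||x] := @MVT R f df a c ac.
- by move=> x; rewrite in_itv/= => /andP[ax _]; apply: hf; exact: lt_trans ax.
- apply: derivable_within_continuous => x; rewrite in_itv/= => /andP[ax _].
  by have [] := hf x (lt_le_trans Aa ax).
by rewrite in_itv/= => xac ->; exists x.
Qed.

Lemma is_derive_continuous f x (df : R) : is_derive x (1:R) f df -> {for x, continuous f}.
Proof. by move=> [h _]; apply/differentiable_continuous/derivable1_diffP. Qed.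

Section Admissible.
Variables (b : R) (p : R -> R) (hp : admissible b p).

Lemma adm_derive x : b < x -> is_derive x (1:R) p (derive1 p x).
Proof. by case: hp => h _ _ _ /h[d1 _ _]; rewrite derive1E; exact: derivableP. Qed.

Lemma adm_incr x y : b < x -> x < y -> p x < p y.
Proof. by case: hp => _ h _ _; exact: h. Qed.

Lemma adm_mono x y : b < x -> x <= y -> p x <= p y.
Proof. by move=> bx; rewrite le_eqVlt => /predU1P[->//|/adm_incr-/(_ bx)/ltW]. Qed.

(** The bounds on the ratio also force p to be positive eventually: where p is
    negative, an increasing p has p (c s) / p s > 1, and where p s = 0 the ratio is 0,
    because division by 0 gives 0. *)
Lemma adm_ratio c : 0 < c < 1 -> exists eps A, [/\ 0 < eps < 1, 0 < A, b < c * A &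
  forall s, A < s -> [/\ 0 < p s, eps * p s < p (c * s) & p (c * s) < (1 - eps) * p s]].
Proof.
move=> c01; have /andP[c0 c1] := c01.
have [_ _ _ /(_ c c01)[eps [eps01 [B [_ hB]]]]] := hp.
pose A := Num.max (Num.max 1 B) (Num.max 0 ((b + 1) / c)).
have A1 : 1 <= A by rewrite !le_max lexx.
have AB : B <= A by rewrite !le_max lexx orbT.
have Ab : (b + 1) / c <= A by rewrite !le_max lexx !orbT.
have bA : b < c * A.
  by rewrite mulrC -ltr_pdivrMr//; apply: lt_le_trans Ab; rewrite ltr_pM2r ?invr_gt0// ltrDl.
exists eps, A; split => //; first exact: lt_le_trans A1.
move=> s As; have s0 : 0 < s by apply: lt_trans As; apply: lt_le_trans A1.
have cs : c * s < s by rewrite gtr_pMl.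
have bcs : b < c * s by apply: lt_trans bA _; rewrite ltr_pM2l.
have := hB s (le_lt_trans AB As) => /andP[h1 h2].
have /andP[e0 e1] := eps01.
have hlt := adm_incr bcs cs.
have ps0 : 0 < p s.
  rewrite ltNge le_eqVlt; apply/negP => /orP[/eqP ps|ps].
    by move: h1; rewrite ps invr0 mulr0 => /(lt_trans e0); rewrite ltxx.
  have : p (c * s) / p s < 1 by apply: lt_trans h2 _; rewrite gtrBl.
  by rewrite ltr_ndivrMr// mul1r => /(lt_trans hlt); rewrite ltxx.
by split => //; [rewrite -ltr_pdivlMr|rewrite -ltr_pdivrMr].
Qed.

Lemma half01 : 0 < (2^-1 : R) < 1.
Proof. by rewrite invr_gt0 invf_lt1 ?ltr0n// ltr1n. Qed.

(** If p were bounded, its supremum S would satisfy S <= (1 - eps) S, as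
    p s < (1 - eps) p (2 s). *)
Lemma adm_unbounded K : exists A, forall s, A < s -> K < p s.
Proof.
have [eps [A [eps01 A0 bA hA]]] := adm_ratio half01.
have /andP[e0 e1] := eps01.
have [[s /andP[As Ks]]|H] := pselect (exists s, (A < s) && (K < p s)).
  exists s => t st; apply: lt_trans Ks _; apply: adm_incr st.
  by apply: lt_trans As; apply: lt_trans bA _; rewrite gtr_pMl//; case/andP: half01.
have {}H s : A < s -> p s <= K.
  by move=> As; rewrite leNgt; apply/negP => Ks; apply: H; exists s; rewrite As.
pose S := [set p s | s in [set s | A < s]].
have hS : has_sup S.
  split; first by exists (p (A + 1)); exists (A + 1) => //=; rewrite ltrDl.
  by exists K => _ [s As <-]; exact: H.
have L s : A < s -> p s <= sup S by move=> As; apply: sup_upper_bound => //; exists s.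
have L0 : 0 < sup S.
  have A1 : A < A + 1 by rewrite ltrDl.
  by apply: lt_le_trans (L _ A1); have [] := hA _ A1.
have [_ [s As <-]] := @sup_adherent _ S (eps * sup S) (mulr_gt0 e0 L0) hS.
have s0 : 0 < s by apply: lt_trans As.
have A2 : A < 2 * s by apply: lt_trans As _; rewrite ltr_pMl// ltr1n.
have [_ _] := hA _ A2; rewrite mulrA mulVf// mul1r => h1 h2.
have := L _ A2; nra.
Qed.

(** The mean value theorem on [s/2, s] and on [s, 2s] yields values of p' on
    both sides of s that are comparable with p s / s; monotonicity of p' brackets
    p' s between them. *)
Lemma adm_derive_bounds : exists A c C, [/\ 0 < A, b < A, 0 < c, 0 < C &
  forall s, A < s -> [/\ 0 < p s, c * p s <= s * derive1 p s &
                        s * derive1 p s <= C * p s]].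
Proof.
have [eps [A [eps01 A0 bA hA]]] := adm_ratio half01.
have /andP[e0 e1] := eps01.
have bA' : b < A by apply: lt_trans bA _; rewrite gtr_pMl//; case/andP: half01.
exists A, eps, (2 / eps); split => //; first by rewrite divr_gt0.
move=> s As; have [ps h1 h2] := hA s As.
have s0 : 0 < s by exact: lt_trans As.
have A2 : A < 2 * s by apply: lt_trans As _; rewrite ltr_pMl// ltr1n.
have := hA _ A2; rewrite mulrA mulVf// mul1r => -[ps2 h3 h4].
have hs : 2^-1 * s < s by rewrite gtr_pMl//; case/andP: half01.
have ss : s < 2 * s by rewrite ltr_pMl// ltr1n.
have bhs : b < 2^-1 * s by apply: lt_trans bA _; rewrite ltr_pM2l ?invr_gt0.
have [x /andP[x1 x2] ex] := mvt_ray adm_derive bhs hs.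
have [y /andP[y1 y2] ey] := mvt_ray adm_derive (lt_trans bhs hs) ss.
have ey' : p (2 * s) - p s = s * derive1 p y by rewrite ey; ring.
have ex' : 2 * (p s - p (2^-1 * s)) = s * derive1 p x by rewrite ex; field.
have bx : b < x by exact: lt_trans x1.
have bs : b < s by exact: lt_trans x2.
have E2 : 2 <= 2 / eps by rewrite ler_pdivlMr// ler_piMr// ltW.
have E3 : p (2 * s) <= p s / eps by rewrite ler_pdivlMr// mulrC ltW.
have P2 : 2 * p s <= 2 / eps * p s by rewrite ler_wpM2r// ltW.
have Pe : p s / eps <= 2 / eps * p s.
  by rewrite [leRHS]mulrAC ler_wpM2r ?invr_ge0 ?(ltW e0)// ler_peMl ?ltW// ltr1n.
have pp2 := adm_incr bs ss.
have phs : 0 < p (2^-1 * s) by apply: lt_trans h1; rewrite mulr_gt0.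
case: hp => _ _ [mono|mono] _.
- have d1 := mono x s bx (ltW x2); have d2 := mono s y bs (ltW y1).
  have := ler_wpM2l (ltW s0) d1; have := ler_wpM2l (ltW s0) d2.
  rewrite -ex' -ey' => g1 g2; split => //.
    apply: le_trans g2; nra.
  apply: le_trans g1 _; lra.
- have d1 := mono x s bx (ltW x2); have d2 := mono s y bs (ltW y1).
  have := ler_wpM2l (ltW s0) d1; have := ler_wpM2l (ltW s0) d2.
  rewrite -ex' -ey' => g1 g2; split => //.
    apply: le_trans g1; nra.
  apply: le_trans g2 _; lra.
Qed.

End Admissible.

(** Here sg = q^-1 (q + r). It satisfies sg s - s = o(s) because
    q ((1 + eta) s) - q s is at least eps q ((1 + eta) s), which exceeds r
    eventually. *)
Lemma time_shift_exists b q r : admissible b q -> 0 < r ->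
  exists A sg, [/\ 0 < A, b < A,
    (forall s, A < s -> 0 < derive1 q s),
    (forall s, A < s -> [/\ s < sg s, q (sg s) = q s + r &
       is_derive s (1:R) sg (derive1 q s / derive1 q (sg s))]) &
    (forall eta, 0 < eta -> exists S, forall s, S < s -> sg s - s <= eta * s)].
Proof.
move=> hq r0; have [A [c [C [A0 bA c0 C0 hA]]]] := adm_derive_bounds hq.
have q'0 s : A < s -> 0 < derive1 q s.
  move=> As; have [ps h1 _] := hA s As; have s0 := lt_trans A0 As.
  rewrite -(pmulr_rgt0 _ s0); apply: lt_le_trans h1; exact: mulr_gt0.
have dq s : A < s -> is_derive s (1:R) q (derive1 q s).
  by move=> As; apply: adm_derive hq _ _; exact: lt_trans As.
have inj s t : A < s -> A < t -> q s = q t -> s = t.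
  move=> As At e; have [st|ts|//] := ltgtP s t.
    by have := adm_incr hq (lt_trans bA As) st; rewrite e ltxx.
  by have := adm_incr hq (lt_trans bA At) ts; rewrite e ltxx.
have surj s y : A < s -> q s <= y -> exists2 t, A < t & q t = y.
  move=> As sy; have [B hB] := adm_unbounded hq y.
  pose B' := Num.max s (B + 1).
  have sB : s <= B' by rewrite le_max lexx.
  have yB : y < q B' by apply: hB; rewrite lt_max ltrDl ltr01 orbT.
  have [||t] := @IVT R q s B' y sB.
  - apply: derivable_within_continuous => x; rewrite in_itv/= => /andP[sx _].
    by have [] := dq x (lt_le_trans As sx).
  - by rewrite ge_min sy/= le_max (ltW yB) orbT.
  by rewrite in_itv/= => /andP[st _] <-; exists t => //; exact: lt_le_trans st.
have /choice[qi hqi] y : exists t, (exists2 s, A < s & q s = y) -> A < t /\ q t = y.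
  by have [[t At e]|n] := pselect (exists2 s, A < s & q s = y); [exists t|exists 0].
have qiK s : A < s -> qi (q s) = s.
  move=> As; have [|h1 h2] := hqi (q s); first by exists s.
  exact: inj.
pose sg s := qi (q s + r).
have sgP s : A < s -> A < sg s /\ q (sg s) = q s + r.
  move=> As; apply: hqi; apply: (surj s) => //; by rewrite lerDl ltW.
have sgs s : A < s -> s < sg s.
  move=> As; have [h1 h2] := sgP s As; rewrite ltNge; apply/negP.
  move=> /(adm_mono hq (lt_trans bA h1)); rewrite h2; lra.
exists A, sg; split => //.
- move=> s As; have [h1 h2] := sgP s As; split => //; first exact: sgs.
  have d1 : is_derive (q (sg s)) (1:R) qi (derive1 q (sg s))^-1.
    apply: is_derive_inverse.
    + have : \forall x \near sg s, A < x by exact: lt_nbhsr.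
      by apply: filterS => x; exact: qiK.
    + have : \forall x \near sg s, A < x by exact: lt_nbhsr.
      by apply: filterS => x /dq/is_derive_continuous.
    + exact: dq.
    + by rewrite gt_eqF// q'0.
  have d2 : is_derive s (1:R) (fun x => q x + r) (derive1 q s).
    have := is_deriveD (dq s As) (is_derive_cst r s (1:R)); rewrite addr0.
    exact.
  rewrite h2 in d1; rewrite mulrC.
  exact: (@is_derive1_comp R qi (fun x => q x + r) s _ _ d1 d2).
- move=> eta eta0; pose c1 := (1 + eta)^-1.
  have e1 : 0 < 1 + eta by rewrite addr_gt0.
  have c01 : 0 < c1 < 1 by rewrite /c1 invr_gt0 e1 invf_lt1// ltrDl.
  have [eps [B [/andP[eps0 _] B0 bB hB]]] := adm_ratio hq c01.
  have [K hK] := adm_unbounded hq (r / eps).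
  exists (Num.max A (Num.max B K)) => s; rewrite !gt_max => /and3P[As Bs Ks].
  have s0 := lt_trans A0 As.
  have ss : s < (1 + eta) * s by rewrite ltr_pMl// ltrDl.
  have [_ _] := hB _ (lt_trans Bs ss).
  rewrite /c1 mulrA mulVf ?gt_eqF// mul1r => h.
  have := hK _ (lt_trans Ks ss); rewrite ltr_pdivrMr// => h'.
  have [h1 h2] := sgP s As.
  rewrite lerBlDr -[X in _ + X]mul1r -mulrDl addrC leNgt; apply/negP.
  move=> /(adm_incr hq (lt_trans bA (lt_trans As ss))); rewrite h2; lra.
Qed.

(** By Cauchy's mean value theorem the increment of p while q gains r is
    r p' x / q' x for some x > s, and p' x / q' x is comparable with p x / q x. *)
Lemma slow_increment b q b' p r A (sg : R -> R) : admissible b q ->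
  admissible b' p -> (p s / q s @[s --> +oo] --> (0:R)) -> 0 < r ->
  (forall s, A < s -> s < sg s /\ q (sg s) = q s + r) ->
  forall e, 0 < e -> exists S, forall s, S < s -> `|p (sg s) - p s| <= e.
Proof.
move=> hq hp pq r0 hsg e e0.
have [Aq [cq [Cq [Aq0 bAq cq0 Cq0 hAq]]]] := adm_derive_bounds hq.
have [Ap [cp [Cp [Ap0 bAp cp0 Cp0 hAp]]]] := adm_derive_bounds hp.
have d0 : 0 < e * cq / (Cp * r) by rewrite divr_gt0 ?mulr_gt0.
have /cvgr0Pnorm_le/(_ _ d0)[B [_ hB]] := pq.
exists (Num.max (Num.max A B) (Num.max Aq Ap)) => s.
rewrite !gt_max => /andP[/andP[As Bs] /andP[Aqs Aps]].
have [ss qs] := hsg s As.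
have [|||||x] := @cauchy_MVT R p (derive1 p) q (derive1 q) s (sg s) ss.
- apply: derivable_within_continuous => x; rewrite in_itv/= => /andP[sx _].
  by have [] := adm_derive hp (lt_trans bAp (lt_le_trans Aps sx)).
- apply: derivable_within_continuous => x; rewrite in_itv/= => /andP[sx _].
  by have [] := adm_derive hq (lt_trans bAq (lt_le_trans Aqs sx)).
- move=> x; rewrite in_itv/= => /andP[sx _].
  by apply: adm_derive hp _ _; exact: (lt_trans bAp (lt_trans Aps sx)).
- move=> x; rewrite in_itv/= => /andP[sx _].
  by apply: adm_derive hq _ _; exact: (lt_trans bAq (lt_trans Aqs sx)).
- move=> x; rewrite in_itv/= => /andP[sx _].
  have [h1 h2 _] := hAq x (lt_trans Aqs sx).
  have x0 := lt_trans Aq0 (lt_trans Aqs sx).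
  rewrite gt_eqF// -(pmulr_rgt0 _ x0); apply: lt_le_trans h2; exact: mulr_gt0.
rewrite in_itv/= qs addrAC subrr add0r => /andP[sx _] e1.
have {e1} -> : p (sg s) - p s = r * (derive1 p x / derive1 q x).
  by rewrite e1 mulrC divfK// gt_eqF.
have [h1 h2 _] := hAq x (lt_trans Aqs sx).
have [g1 g2 g3] := hAp x (lt_trans Aps sx).
have x0 := lt_trans Aq0 (lt_trans Aqs sx).
have xq : 0 < x * derive1 q x by apply: lt_le_trans h2; exact: mulr_gt0.
have xp : 0 < x * derive1 p x by apply: lt_le_trans g2; exact: mulr_gt0.
have -> : derive1 p x / derive1 q x = (x * derive1 p x) / (x * derive1 q x).
  by rewrite invfM mulrACA divff ?mul1r// gt_eqF.
rewrite ger0_norm; last by rewrite mulr_ge0 ?divr_ge0 ?ltW.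
have k1 := le_trans (ler_norm _) (hB x (lt_trans Bs sx)).
rewrite mulrA ler_pdivrMr//.
apply: le_trans (_ : r * (Cp * p x) <= _); first by rewrite ler_pM2l.
apply: le_trans (_ : _ <= e * (cq * q x)) _; last by rewrite ler_pM2l.
move: k1; rewrite ler_pdivrMr// mulrAC ler_pdivlMr ?mulr_gt0// => k1.
by apply: le_trans (le_trans k1 _); rewrite le_eqVlt; apply/orP; left; apply/eqP; ring.
Qed.

End RealLine.

(** * Averages along a shifted clock *)

Section Shift.
Context (R : realType).
Local Notation leb := (@lebesgue_measure R).
Implicit Types (A M : R) (f : R -> R).

Definition cont_ray A f := forall s, A < s -> {for s, continuous f}.

Lemma cont_ray_within A f x y : cont_ray A f -> A < x ->
  {within `[x, y], continuous f}.
Proof.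
move=> hf Ax; apply: continuous_in_subspaceT => s.
by rewrite inE/= in_itv/= => /andP[xs _]; apply: hf; exact: lt_le_trans xs.
Qed.

Lemma cont_ray_integrable A f x y : cont_ray A f -> A < x ->
  leb.-integrable `[x, y] (EFin \o f).
Proof.
move=> hf Ax; apply: continuous_compact_integrable; first exact: segment_compact.
exact: cont_ray_within hf Ax.
Qed.

Lemma antiderivative A f a : cont_ray A f -> A < a ->
  exists F : R -> R, (forall s, a < s -> is_derive s (1:R) F (f s)) /\
    forall x y, a < x -> x <= y -> \int[leb]_(s in `[x, y]) f s = F y - F x.
Proof.
move=> hf Aa; pose F y := \int[leb]_(s in `[a, y]) f s.
exists F; split.
  move=> s as_; have [|||h1 h2] := @continuous_FTC1_closed R f a s (s + 1) _ _ as_.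
  - by rewrite ltrDl.
  - exact: cont_ray_integrable hf Aa.
  - by apply: hf; exact: lt_trans as_.
  by rewrite -h2 derive1E; exact: derivableP.
move=> x y ax xy; rewrite /F Rintegral_itvB//.
- rewrite Rintegral_itv_obnd_cbnd//.
  apply: integrableS (cont_ray_integrable y hf Aa) => //.
  by apply: subset_itv; rewrite bnd_simp// ltW.
- exact: cont_ray_integrable hf Aa.
- by rewrite bnd_simp ltW.
Qed.

(** Let L and K be antiderivatives of psi o sg - psi and of psi. Then
    H = L + K - K o sg has derivative psi (sg s) (1 - sg' s), where 1 - sg' has
    constant sign. So H varies by at most M times the variation of sg - id, and
    L differs from H by values of K over [a, sg a] and [tau, sg tau]. *)
Lemma shift_integral A (sg dsg psi : R -> R) M a tau :
  (forall s, A < s -> s < sg s) ->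
  (forall s, A < s -> is_derive s (1:R) sg (dsg s)) ->
  (forall s, A < s -> dsg s <= 1) \/ (forall s, A < s -> 1 <= dsg s) ->
  cont_ray A psi -> (forall s, A < s -> `|psi s| <= M) ->
  A < a -> a <= tau ->
  `|\int[leb]_(s in `[a, tau]) (psi (sg s) - psi s)|
    <= 2 * M * ((sg a - a) + (sg tau - tau)).
Proof.
move=> hsg dsgP mono cpsi bpsi Aa at_.
have M0 : 0 <= M by apply: le_trans (bpsi a Aa).
have At := lt_le_trans Aa at_.
pose a0 := (A + a) / 2.
have Aa0 : A < a0 by rewrite /a0; lra.
have a0a : a0 < a by rewrite /a0; lra.
have csg : cont_ray A (psi \o sg).
  move=> s As; apply: continuous_comp; first exact: is_derive_continuous (dsgP s As).
  by apply: cpsi; apply: lt_trans (hsg s As).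
have cdiff : cont_ray A (fun s => psi (sg s) - psi s).
  by move=> s As; apply: continuousB; [exact: csg|exact: cpsi].
have [L [dL ->//]] := antiderivative cdiff Aa0.
have [K [dK _]] := antiderivative cpsi Aa0.
have Kb x y : a0 < x -> x < y -> `|K y - K x| <= M * (y - x).
  move=> a0x xy; have [c /andP[xc _] ->] := mvt_ray dK a0x xy.
  rewrite normrM (gtr0_norm (x := y - x)) ?subr_gt0// ler_wpM2r ?subr_ge0 ?(ltW xy)//.
  by apply: bpsi; apply: lt_trans Aa0 (lt_trans a0x xc).
pose H y := L y + K y - K (sg y).
have dH y : a0 < y -> is_derive y (1:R) H (psi (sg y) * (1 - dsg y)).
  move=> a0y; have Ay := lt_trans Aa0 a0y.
  have d1 := is_derive1_comp (dK (sg y) (lt_trans a0y (hsg y Ay))) (dsgP y Ay).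
  have := is_deriveB (is_deriveD (dL y a0y) (dK y a0y)) d1.
  by rewrite subrK mulrBr mulr1.
have Hb : `|H tau - H a| <= M * ((sg a - a) + (sg tau - tau)).
  have da := hsg a Aa; have dt := hsg tau At.
  move: at_; rewrite le_eqVlt => /predU1P[<-|at_].
    by rewrite subrr normr0 mulr_ge0// addr_ge0// subr_ge0 ltW.
  (* H + M (sg - id) and H - M (sg - id) are monotone in opposite directions,
     whichever sign 1 - sg' has. *)
  have dG e y : a0 < y ->
      is_derive y (1:R) (fun y => H y + e * (sg y - y)) (psi (sg y) * (1 - dsg y) + e * (dsg y - 1)).
    move=> a0y; have Ay := lt_trans Aa0 a0y.
    have d1 := is_deriveB (dsgP y Ay) (is_derive_id y (1:R)).
    have := is_deriveD (dH y a0y) (is_deriveZ e d1).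
    exact.
  have [c1 /andP[ac1 _] e1] := mvt_ray (dG M) a0a at_.
  have [c2 /andP[ac2 _] e2] := mvt_ray (dG (- M)) a0a at_.
  have ta : 0 < tau - a by rewrite subr_gt0.
  have p1 : - M <= psi (sg c1) <= M.
    by rewrite -ler_norml bpsi//; apply: lt_trans (hsg c1 _); exact: lt_trans ac1.
  have p2 : - M <= psi (sg c2) <= M.
    by rewrite -ler_norml bpsi//; apply: lt_trans (hsg c2 _); exact: lt_trans ac2.
  have /andP[q1 q1'] := p1; have /andP[q2 q2'] := p2.
  rewrite ler_norml; case: mono => mono.
  - have m1 := mono c1 (lt_trans Aa ac1); have m2 := mono c2 (lt_trans Aa ac2).
    have s1 : psi (sg c1) * (1 - dsg c1) + M * (dsg c1 - 1) <= 0 by nra.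
    have s2 : 0 <= psi (sg c2) * (1 - dsg c2) + - M * (dsg c2 - 1) by nra.
    have t1 := mulr_le0_ge0 s1 (ltW ta); have t2 := mulr_ge0 s2 (ltW ta).
    rewrite -e1 in t1; rewrite -e2 in t2.
    have u1 : 0 <= M * (sg a - a) by rewrite mulr_ge0// subr_ge0 ltW.
    have u2 : 0 <= M * (sg tau - tau) by rewrite mulr_ge0// subr_ge0 ltW.
    by apply/andP; split; lra.
  - have m1 := mono c1 (lt_trans Aa ac1); have m2 := mono c2 (lt_trans Aa ac2).
    have s1 : 0 <= psi (sg c1) * (1 - dsg c1) + M * (dsg c1 - 1) by nra.
    have s2 : psi (sg c2) * (1 - dsg c2) + - M * (dsg c2 - 1) <= 0 by nra.
    have t1 := mulr_ge0 s1 (ltW ta); have t2 := mulr_le0_ge0 s2 (ltW ta).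
    rewrite -e1 in t1; rewrite -e2 in t2.
    have u1 : 0 <= M * (sg a - a) by rewrite mulr_ge0// subr_ge0 ltW.
    have u2 : 0 <= M * (sg tau - tau) by rewrite mulr_ge0// subr_ge0 ltW.
    by apply/andP; split; lra.
have -> : L tau - L a = (H tau - H a) + (K (sg tau) - K tau) - (K (sg a) - K a).
  by rewrite /H; ring.
have k1 := Kb tau (sg tau) (lt_le_trans a0a at_) (hsg tau At).
have k2 := Kb a (sg a) a0a (hsg a Aa).
apply: le_trans (ler_normB _ _) _; apply: le_trans (lerD (ler_normD _ _) (lexx _)) _.
lra.
Qed.

(** Uniformity in psi allows it to depend on a test function that varies with
    tau. The ray on which psi is controlled may start later than the one where sg
    is defined. *)
Lemma shift_average b q r : admissible b q -> 0 < r ->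
  exists A sg, [/\ 0 < A, b < A,
    (forall s, A < s -> s < sg s /\ q (sg s) = q s + r),
    cont_ray A sg &
    forall A' a e, A <= A' -> A' < a -> 0 < e -> exists S, forall tau psi M, S < tau ->
      cont_ray A' psi -> (forall s, A' < s -> `|psi s| <= M) ->
      `|\int[leb]_(s in `[a, tau]) (psi (sg s) - psi s)| <= e * M * tau].
Proof.
move=> hq r0; have [A [sg [A0 bA q'0 hsg sgo]]] := time_shift_exists hq r0.
exists A, sg; split => //.
- by move=> s /hsg[].
- by move=> s /hsg[_ _ /is_derive_continuous].
move=> A' a e AA' Aa e0.
have [S hS] := sgo (e / 4) (divr_gt0 e0 (ltr0n _ 4)).
exists (Num.max (Num.max S a) (4 * (sg a - a) / e)) => tau psi M.
rewrite !gt_max => /andP[/andP[St at_] et] cpsi bpsi.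
have M0 : 0 <= M by apply: le_trans (bpsi a Aa).
have A'A s : A' < s -> A < s by exact: le_lt_trans.
apply: le_trans (shift_integral (A := A') (dsg := fun s => derive1 q s / derive1 q (sg s)) _ _ _ cpsi bpsi Aa (ltW at_)) _.
- by move=> s /A'A/hsg[].
- by move=> s /A'A/hsg[_ _]; exact.
- have ratio s : A < s -> (derive1 q s / derive1 q (sg s) <= 1) = (derive1 q s <= derive1 q (sg s)).
    by move=> As; rewrite ler_pdivrMr ?mul1r// q'0//; have [h _ _] := hsg s As; exact: lt_trans h.
  have ratio' s : A < s -> (1 <= derive1 q s / derive1 q (sg s)) = (derive1 q (sg s) <= derive1 q s).
    by move=> As; rewrite ler_pdivlMr ?mul1r// q'0//; have [h _ _] := hsg s As; exact: lt_trans h.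
  have [_ _ [mono|mono] _] := hq; [left|right] => s /A'A As.
    by rewrite /= ratio//; have [h _ _] := hsg s As; apply: mono; [exact: lt_trans As|exact: ltW].
  by rewrite /= ratio'//; have [h _ _] := hsg s As; apply: mono; [exact: lt_trans As|exact: ltW].
have h := hS _ St.
move: et; rewrite ltr_pdivrMr// => et.
rewrite (_ : 2 * M * _ = M * (2 * (sg a - a + (sg tau - tau)))); last by ring.
rewrite [leRHS](_ : _ = M * (e * tau)); last by ring.
rewrite ler_wpM2l//; lra.
Qed.

End Shift.

(** * Products of functions moved by commuting flows *)

Section CommutingActions.
Context d (X : measurableType d) (R : realType) (mu : probability X R).
Local Notation nrm := (l2norm mu).
Local Notation L2 := (L2 mu).
Local Notation L1 := (L1 mu).

Lemma normc_real (x : R) : Normc.normc (x%:C)%C = `|x|.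
Proof. by rewrite /Normc.normc /= expr0n/= addr0 sqrtr_sqr. Qed.

Lemma cLnorm1_real (w : X -> R) : L1 w ->
  cLnorm mu 1%E (fun x => ((w x)%:C)%C) = (\int[mu]_x `|w x|)%:E.
Proof.
move=> hw; rewrite /cLnorm Lnorm1 -L1_EFin; last exact: integrable_norm.
  by apply: eq_integral => x _; rewrite normc_real abse_EFin normr_id.
by apply: measurableT_comp => //; exact: L1_meas hw.
Qed.

Lemma action_near (T : R -> X -> X) M (g : X -> R) e :
  measure_preserving_action mu T -> continuous_action mu T -> bdd M g -> 0 < e ->
  \forall s \near (0:R), nrm (fun x => g (T s x) - g x) <= e.
Proof.
move=> hT hc hg e0; have M0 := bdd_ge0 hg.
have Lg := L1_bdd mu hg.
have Lp : in_Lp mu 1%E (fun x => ((g x)%:C)%C).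
  split; first by split; [case: hg|exact: measurable_cst].
  by rewrite cLnorm1_real// ltry.
have := hc _ Lp 0.
have h s x : ((g (T s x))%:C)%C - ((g (T 0 x))%:C)%C = ((g (T s x) - g x)%:C)%C.
  by rewrite (act0 hT) -rmorphB.
have hTs s := act_mp hT s.
have bs s : bdd (M + M) (fun x => g (T s x) - g x).
  exact: (bddB (mp_bdd (hTs s) hg) hg).
have -> : (fun s => cLnorm mu 1%E (fun x => ((g (T s x))%:C)%C - ((g (T 0 x))%:C)%C)) =
    (fun s => (\int[mu]_x `|g (T s x) - g x|)%:E).
  apply/funext => s; rewrite -cLnorm1_real; last exact: L1_bdd (bs s).
  by congr cLnorm; apply/funext => x; rewrite h.
move=> /fine_cvgP[_ /cvgr0Pnorm_le] /(_ (e ^+ 2 / (M + M + 1))).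
have M1 : 0 < M + M + 1 by rewrite ltr_wpDl// addr_ge0.
rewrite divr_gt0 ?exprn_gt0// => /(_ erefl); apply: filterS => s /= hs.
rewrite -ler_sqr ?nnegrE ?nrm_ge0 ?(ltW e0)//.
apply: le_trans (nrm_sq_bdd mu (bs s)) _.
have := le_trans (ler_norm _) hs; rewrite ler_pdivlMr// => {}hs.
apply: le_trans hs; rewrite mulrC ler_wpM2l ?lerDl//.
by apply: Rintegral_ge0.
Qed.

Section Composite.
Variables (J : eqType) (T : J -> R -> X -> X).
Hypothesis hT : forall j, measure_preserving_action mu (T j).
Hypothesis hcomm : forall j j' s s', T j s \o T j' s' = T j' s' \o T j s.

(** Composition over a list of indices, the form of [composite_map] on which one
    can argue by induction. *)
Definition comp_along (r : seq J) (a : J -> R) : X -> X :=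
  \big[(fun g h : X -> X => g \o h)/id]_(j <- r) T j (a j).

Lemma comp_along_cons j r a x : comp_along (j :: r) a x = T j (a j) (comp_along r a x).
Proof. by rewrite /comp_along big_cons. Qed.

Lemma comp_along_nil a x : comp_along [::] a x = x.
Proof. by rewrite /comp_along big_nil. Qed.

Lemma comp_along_mp r a : measure_preserving mu (comp_along r a).
Proof.
elim: r => [|j r ih].
  by rewrite (_ : comp_along _ _ = id); [exact: mp_id|apply/funext => x; rewrite comp_along_nil].
rewrite (_ : comp_along _ _ = T j (a j) \o comp_along r a).
  exact: mp_comp (act_mp (hT j) _) ih.
by apply/funext => x; rewrite comp_along_cons.
Qed.

Lemma comp_along_comm r a j s x : comp_along r a (T j s x) = T j s (comp_along r a x).
Proof.
elim: r => [|i r ih]; first by rewrite !comp_along_nil.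
by rewrite !comp_along_cons ih; have /(congr1 (fun f => f (comp_along r a x))) := hcomm i j (a i) s.
Qed.

(** Times are changed one index at a time. As the maps commute and preserve
    norms, a change in one index costs the displacement of g under that flow
    alone. *)
Lemma comp_along_dist (g : X -> R) r a a' : L2 g ->
  nrm (fun x => g (comp_along r a x) - g (comp_along r a' x)) <=
  \sum_(j <- r) nrm (fun x => g (T j (a j - a' j) x) - g x).
Proof.
move=> hg; elim: r => [|j r ih].
  rewrite big_nil (nrm_eq mu (g := fun=> 0)); last by move=> x; rewrite !comp_along_nil subrr.
  by rewrite /nrm expr0n/= intC sqrtr0.
have m1 := mp_L2 (act_mp (hT j) (a j)) hg; have m2 := mp_L2 (act_mp (hT j) (a' j)) hg.
have c1 := comp_along_mp r a; have c2 := comp_along_mp r a'.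
rewrite big_cons.
have := nrm_dist3 (mp_L2 c1 m1) (mp_L2 c1 m2) (mp_L2 c2 m2).
rewrite (nrm_eq mu (g := fun x => g (comp_along (j :: r) a x) - g (comp_along (j :: r) a' x))); last first.
  by move=> x; rewrite !comp_along_cons.
move=> /le_trans; apply; apply: lerD.
  rewrite (mp_nrm_dist c1 m1 m2).
  have m3 := mp_L2 (act_mp (hT j) (a j - a' j)) hg.
  rewrite -(mp_nrm_dist (act_mp (hT j) (a' j)) m3 hg) le_eqVlt.
  apply/orP; left; apply/eqP; apply: nrm_eq => x /=.
  by rewrite -(act_add (hT j)) subrK.
apply: le_trans ih.
have l1 := mp_L2 c1 hg; have l2 := mp_L2 c2 hg.
rewrite -(mp_nrm_dist (act_mp (hT j) (a' j)) l1 l2) le_eqVlt.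
apply/orP; left; apply/eqP; apply: nrm_eq => x /=.
by rewrite !comp_along_comm.
Qed.

End Composite.

Lemma bdd_prod I (r : seq I) (P : pred I) M (F : I -> X -> R) : 1 <= M ->
  (forall i, bdd M (F i)) -> bdd (M ^+ size r) (fun x => \prod_(i <- r | P i) F i x).
Proof.
move=> M1 hF; have M0 : 0 <= M by exact: le_trans M1.
elim: r => [|i r ih].
  rewrite (_ : (fun x => _) = fun=> 1); last by apply/funext => x; rewrite big_nil.
  by apply: bdd_le (bdd_cst _ 1); rewrite normr1.
rewrite /= exprS; case Pi: (P i).
  rewrite (_ : (fun x => _) = fun x => F i x * \prod_(j <- r | P j) F j x).
    exact: bddM.
  by apply/funext => x; rewrite big_cons Pi.
rewrite (_ : (fun x => _) = fun x => \prod_(j <- r | P j) F j x).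
  by apply: bdd_le ih; rewrite ler_peMl// exprn_ge0.
by apply/funext => x; rewrite big_cons Pi.
Qed.

(** The factors are exchanged one after another. *)
Lemma prod_dist I (r : seq I) (P : pred I) M (F G : I -> X -> R) : 1 <= M ->
  (forall i, bdd M (F i)) -> (forall i, bdd M (G i)) ->
  nrm (fun x => \prod_(i <- r | P i) F i x - \prod_(i <- r | P i) G i x) <=
  M ^+ size r * \sum_(i <- r | P i) nrm (fun x => F i x - G i x).
Proof.
move=> M1 hF hG; have M0 : 0 <= M by exact: le_trans M1.
elim: r => [|i r ih].
  rewrite (nrm_eq mu (g := fun=> 0)); last by move=> x; rewrite !big_nil subrr.
  by rewrite /nrm expr0n/= intC sqrtr0 big_nil mulr0.
have bF := bdd_prod r P M1 hF; have bG := bdd_prod r P M1 hG.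
rewrite big_cons /= exprS; case Pi: (P i); last first.
  rewrite (nrm_eq mu (g := fun x => \prod_(j <- r | P j) F j x - \prod_(j <- r | P j) G j x)); last first.
    by move=> x; rewrite !big_cons Pi.
  apply: le_trans ih _; rewrite -mulrA ler_peMl// mulr_ge0 ?exprn_ge0//.
  by apply: sumr_ge0 => j _; exact: nrm_ge0.
have LF j : L2 (F j) by exact: bdd_L2.
have LG j : L2 (G j) by exact: bdd_L2.
have h1 := nrm_mulbdd bF (L2B (LF i) (LG i)).
have h2 := nrm_mulbdd (hG i) (L2B (bdd_L2 mu bF) (bdd_L2 mu bG)).
have L1' := bdd_mul_L2 bF (L2B (LF i) (LG i)).
have L2' := bdd_mul_L2 (hG i) (L2B (bdd_L2 mu bF) (bdd_L2 mu bG)).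
apply: le_trans (_ : nrm (fun x => \prod_(j <- r | P j) F j x * (F i x - G i x) +
   G i x * (\prod_(j <- r | P j) F j x - \prod_(j <- r | P j) G j x)) <= _).
  by rewrite le_eqVlt; apply/orP; left; apply/eqP; apply: nrm_eq => x; rewrite !big_cons Pi; ring.
apply: le_trans (nrmD L1' L2') _; rewrite mulrDr; apply: lerD.
  apply: le_trans h1 _; rewrite ler_wpM2r ?nrm_ge0//.
  by rewrite ler_peMl// exprn_ge0.
by apply: le_trans h2 _; rewrite -mulrA ler_wpM2l.
Qed.

Section System.
Variables (k l : nat) (T : 'I_k -> 'I_l -> R -> X -> X).
Hypothesis hT : forall i j, measure_preserving_action mu (T i j).
Hypothesis hTc : forall i j, continuous_action mu (T i j).
Hypothesis hcomm : forall i i' j j' s s',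
     T i j s \o T i' j' s' = T i' j' s' \o T i j s.

Definition comp_at i (a : 'I_l -> R) : X -> X := comp_along (T i) (index_enum _) a.

Lemma comp_at_mp i a : measure_preserving mu (comp_at i a).
Proof. exact: comp_along_mp. Qed.

Definition moving_prod (u : 'I_k -> X -> R) (P : pred 'I_k) (a : 'I_k -> 'I_l -> R) x :=
  \prod_(i < k | P i) u i (comp_at i (a i) x).

Lemma moving_prod_bdd M u (P : pred 'I_k) : 1 <= M -> (forall i, bdd M (u i)) ->
  exists2 N : R, 1 <= N & forall a, bdd N (moving_prod u P a).
Proof.
move=> M1 hu; exists (M ^+ size (index_enum 'I_k)); first exact: exprn_ege1.
by move=> a; apply: bdd_prod => // i; apply: (mp_bdd (comp_at_mp i (a i)) (hu i)).
Qed.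

(** Only the displacements of the finitely many u i under the single flows near
    time 0 matter. Uniformity serves twice: for continuity in s and for the
    comparison of two times between which the slow flows hardly move. *)
Lemma moving_prod_unif M u (P : pred 'I_k) (e : R) : 1 <= M -> (forall i, bdd M (u i)) -> 0 < e ->
  exists2 delta : R, 0 < delta & forall a a' : 'I_k -> 'I_l -> R,
    (forall i j, P i -> `|a i j - a' i j| < delta) ->
    nrm (fun x => moving_prod u P a x - moving_prod u P a' x) <= e.
Proof.
move=> M1 hu e0; pose N := M ^+ size (index_enum 'I_k) * (k%:R * l%:R) + 1.
have N0 : 0 < N.
  by rewrite /N ltr_wpDl// !mulr_ge0// exprn_ge0// (le_trans ler01).
have en : 0 < e / N by rewrite divr_gt0.
have : \forall s \near (0:R), forall i j, nrm (fun x => u i (T i j s x) - u i x) <= e / N.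
  apply: (@filter_forall _ _ _ (nbhs (0:R)) _) => i.
  apply: (@filter_forall _ _ _ (nbhs (0:R)) _) => j.
  exact: action_near (hT i j) (hTc i j) (hu i) en.
move=> /nbhs_ballP[delta /= d0 hd]; exists delta => // a a' haa.
have hui i : L2 (u i) by exact: bdd_L2.
apply: le_trans (prod_dist (M := M) _ _ _ _ _) _ => //.
- by move=> i; apply: (mp_bdd (comp_at_mp i (a i)) (hu i)).
- by move=> i; apply: (mp_bdd (comp_at_mp i (a' i)) (hu i)).
have : \sum_(i < k | P i) nrm (fun x => u i (comp_at i (a i) x) - u i (comp_at i (a' i) x)) <=
    k%:R * l%:R * (e / N).
  apply: le_trans (_ : \sum_(i < k | P i) l%:R * (e / N) <= _).
    apply: ler_sum => i Pi.
    apply: le_trans (comp_along_dist (hT i) _ _ _ _ (hui i)) _; first exact: hcomm.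
    rewrite -[X in X%:R * _](card_ord l) mulr_natl -sumr_const.
    apply: ler_sum => j _; apply: hd.
    by rewrite -ball_normE /= sub0r normrN haa.
  rewrite sumr_const -mulrA.
  have q0 : 0 <= l%:R * (e / N) by apply: mulr_ge0 => //; exact: ltW.
  rewrite -[leLHS]mulr_natl; apply: ler_wpM2r => //.
  by rewrite ler_nat -[leqRHS](card_ord k) max_card.
move=> h; apply: le_trans (ler_wpM2l _ h) _.
  by rewrite exprn_ge0// (le_trans ler01).
rewrite [leLHS](_ : _ = e * (M ^+ size (index_enum 'I_k) * (k%:R * l%:R)) / N).
  by rewrite ler_pdivrMr// ler_wpM2l ?(ltW e0)// /N lerDl.
by move: N^-1 => c; ring.
Qed.

End System.
End CommutingActions.

(** * Families whose averages tend weakly to zero *)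

Section RayIntegral.
Context (R : realType).
Local Notation leb := (@lebesgue_measure R).

Lemma int_ray_bound A f B (a tau : R) : cont_ray A f -> A < a -> a <= tau ->
  (forall s, a <= s <= tau -> `|f s| <= B) ->
  `|\int[leb]_(s in `[a, tau]) f s| <= B * (tau - a).
Proof.
move=> cf Aa at_ fB; pose a0 := (A + a) / 2.
have Aa0 : A < a0 by rewrite /a0; lra.
have a0a : a0 < a by rewrite /a0; lra.
have [F [dF ->//]] := antiderivative cf Aa0.
move: at_; rewrite le_eqVlt => /predU1P[<-|at_]; first by rewrite !subrr normr0 mulr0.
have [c /andP[ac ct] ->] := mvt_ray dF a0a at_.
rewrite normrM (gtr0_norm (x := tau - a)) ?subr_gt0// ler_wpM2r ?subr_ge0 ?(ltW at_)//.
by apply: fB; rewrite !ltW.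
Qed.

Lemma int_ray_split A f (a b c : R) : cont_ray A f -> A < a -> a <= b -> b <= c ->
  \int[leb]_(s in `[a, c]) f s =
  \int[leb]_(s in `[a, b]) f s + \int[leb]_(s in `[b, c]) f s.
Proof.
move=> cf Aa ab bc; pose a0 := (A + a) / 2.
have Aa0 : A < a0 by rewrite /a0; lra.
have a0a : a0 < a by rewrite /a0; lra.
have [F [_ hF]] := antiderivative cf Aa0.
rewrite !hF//; [ring|exact: lt_le_trans ab|exact: le_trans bc].
Qed.

Lemma int_rayD A f g (a c : R) : cont_ray A f -> cont_ray A g -> A < a ->
  \int[leb]_(s in `[a, c]) (f s + g s) =
  \int[leb]_(s in `[a, c]) f s + \int[leb]_(s in `[a, c]) g s.
Proof.
move=> cf cg Aa; apply: RintegralD => //; exact: cont_ray_integrable Aa.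
Qed.

Lemma int_rayZ A f (e a c : R) : cont_ray A f -> A < a ->
  \int[leb]_(s in `[a, c]) (e * f s) = e * \int[leb]_(s in `[a, c]) f s.
Proof.
by move=> cf Aa; apply: RintegralZl => //; exact: cont_ray_integrable Aa.
Qed.

End RayIntegral.

Section Averages.
Context d (X : measurableType d) (R : realType) (mu : probability X R).
Local Notation nrm := (l2norm mu).
Local Notation L2 := (L2 mu).
Local Notation L1 := (L1 mu).
Local Notation leb := (@lebesgue_measure R).

Definition pairing (f h : X -> R) := \int[mu]_x (f x * h x).

(** Regularity makes the pairings with fixed elements of L2 continuous in time,
    and hence integrable without joint measurability. *)
Definition regular A (w : R -> X -> R) :=
  (exists N, forall s, bdd N (w s)) /\
  forall s, A < s -> forall e, 0 < e ->
    \forall t \near s, nrm (fun x => w t x - w s x) <= e.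

(** The averages tend to 0 weakly, uniformly over test functions of norm at most
    1: the threshold S does not depend on h, which may thus depend on tau. *)
Definition null_average A (w : R -> X -> R) :=
  forall a, A < a -> forall e, 0 < e -> exists S, forall tau h, S < tau -> L2 h ->
    `|\int[leb]_(s in `[a, tau]) pairing (w s) h| <= e * tau * nrm h.

Lemma regular_L2 A w s : regular A w -> L2 (w s).
Proof. by case=> -[N hN] _; exact: bdd_L2 (hN s). Qed.

Lemma pairingD f g h : L2 f -> L2 g -> L2 h ->
  pairing (fun x => f x + g x) h = pairing f h + pairing g h.
Proof.
move=> hf hg hh; rewrite /pairing -intD; [|exact: L2_L1M|exact: L2_L1M].
by apply: eq_Rintegral => x _; rewrite mulrDl.
Qed.

Lemma pairingZ e f h : L2 f -> L2 h -> pairing (fun x => e * f x) h = e * pairing f h.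
Proof.
move=> hf hh; rewrite /pairing -intZ; last exact: L2_L1M.
by apply: eq_Rintegral => x _; rewrite mulrA.
Qed.

Lemma pairingB f g h : L2 f -> L2 g -> L2 h ->
  pairing (fun x => f x - g x) h = pairing f h - pairing g h.
Proof.
move=> hf hg hh; rewrite /pairing -intB; [|exact: L2_L1M|exact: L2_L1M].
by apply: eq_Rintegral => x _; rewrite mulrBl.
Qed.

Lemma regular_pairing_cont A w h : regular A w -> L2 h -> cont_ray A (fun s => pairing (w s) h).
Proof.
move=> gw hh s As; apply/cvgrPdist_le => e e0.
have h0 := nrm_ge0 mu h.
have h1 : 0 < nrm h + 1 by rewrite ltr_wpDl.
case: (gw) => _ /(_ s As (e / (nrm h + 1)) (divr_gt0 e0 h1)).
apply: filterS => t ht.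
rewrite distrC -pairingB//; [|exact: regular_L2 gw|exact: regular_L2 gw].
apply: le_trans (cauchy_schwarz (L2B (regular_L2 t gw) (regular_L2 s gw)) hh) _.
apply: le_trans (ler_wpM2r h0 ht) _.
by rewrite mulrAC ler_pdivrMr// ler_wpM2l ?(ltW e0)// lerDl.
Qed.

Lemma regular_lin A w1 w2 e1 e2 : regular A w1 -> regular A w2 ->
  regular A (fun s x => e1 * w1 s x + e2 * w2 s x).
Proof.
move=> g1 g2; split.
  case: g1 g2 => -[N1 h1] _ [[N2 h2] _]; exists (`|e1| * N1 + `|e2| * N2) => s.
  by apply: bddD; apply: bddZ.
move=> s As e e0; pose D := `|e1| + `|e2| + 1.
have D0 : 0 < D by rewrite ltr_wpDl// addr_ge0.
have eD : 0 < e / D by exact: divr_gt0.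
have L1t t := regular_L2 t g1; have L2t t := regular_L2 t g2.
case: g1 g2 => _ /(_ s As _ eD) h1 [_ /(_ s As _ eD)].
apply: filterS2 h1 => t h1 h2.
rewrite (nrm_eq mu (g := fun x => e1 * (w1 t x - w1 s x) + e2 * (w2 t x - w2 s x))); last first.
  by move=> x; ring.
have m1 := L2B (L1t t) (L1t s); have m2 := L2B (L2t t) (L2t s).
apply: le_trans (nrmD (L2Z e1 m1) (L2Z e2 m2)) _; rewrite !nrmZ//.
apply: le_trans (lerD (ler_wpM2l (normr_ge0 e1) h1) (ler_wpM2l (normr_ge0 e2) h2)) _.
rewrite -mulrDl mulrCA -[leRHS]mulr1 ler_wpM2l ?(ltW e0)//.
by rewrite ler_pdivrMr// mul1r lerDl.
Qed.

Lemma regular_sub A A' w : A <= A' -> regular A w -> regular A' w.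
Proof. by move=> AA' [h1 h2]; split=> // s As; apply: h2; exact: le_lt_trans As. Qed.

(** The base point of the integration may depend on e: moving it changes the
    integral by a bounded amount, which is o(tau). *)
Lemma null_average_intro A w : 0 <= A -> regular A w ->
  (forall e, 0 < e -> exists a S, A < a /\ forall tau h, S < tau -> L2 h ->
    `|\int[leb]_(s in `[a, tau]) pairing (w s) h| <= e * tau * nrm h) -> null_average A w.
Proof.
move=> A0 gw hw a0 Aa0 e e0; have e2 : 0 < e / 2 by rewrite divr_gt0.
have [a [S [Aa hS]]] := hw _ e2.
case: (gw) => -[N hN] _; have N0 := bdd_ge0 (hN 0).
pose dd := `|a - a0|.
exists (Num.max (Num.max S (2 * N * dd / e)) (Num.max a a0)) => tau h.
rewrite !gt_max => /andP[/andP[St dt] /andP[at_ a0t]] hh.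
have cpr := regular_pairing_cont gw hh.
have h0 := nrm_ge0 mu h.
have bpr s : `|pairing (w s) h| <= N * nrm h.
  apply: le_trans (cauchy_schwarz (regular_L2 s gw) hh) _.
  by rewrite ler_wpM2r//; exact: nrm_bdd.
have main : `|\int[leb]_(s in `[a0, tau]) pairing (w s) h -
    \int[leb]_(s in `[a, tau]) pairing (w s) h| <= N * nrm h * dd.
  have [aa|/ltW aa] := leP a0 a.
    rewrite (int_ray_split cpr Aa0 aa (ltW at_)) addrK /dd (ger0_norm (x := a - a0)) ?subr_ge0//.
    exact: (int_ray_bound cpr Aa0 aa).
  rewrite (int_ray_split cpr Aa aa (ltW a0t)) opprD addrCA subrr addr0 normrN.
  rewrite /dd distrC (ger0_norm (x := a0 - a)) ?subr_ge0//.
  exact: (int_ray_bound cpr Aa aa).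
have {main} := le_trans (ler_normD _ _) (lerD main (hS _ _ St hh)).
have k : N * nrm h * dd <= e / 2 * tau * nrm h.
  rewrite mulrAC ler_wpM2r//.
  by move: dt; rewrite ltr_pdivrMr// => dt; lra.
rewrite subrK => main.
by apply: le_trans main _; lra.
Qed.

Lemma null_average_lin A w1 w2 e1 e2 : 0 <= A -> regular A w1 -> regular A w2 ->
  null_average A w1 -> null_average A w2 -> null_average A (fun s x => e1 * w1 s x + e2 * w2 s x).
Proof.
move=> A0 g1 g2 h1 h2 a Aa e e0; pose D := `|e1| + `|e2| + 1.
have D0 : 0 < D by rewrite ltr_wpDl// addr_ge0.
have eD : 0 < e / D by exact: divr_gt0.
have [S1 {}h1] := h1 a Aa _ eD; have [S2 {}h2] := h2 a Aa _ eD.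
exists (Num.max (Num.max S1 S2) A) => tau h; rewrite !gt_max => /andP[/andP[St1 St2] At] hh.
have c1 := regular_pairing_cont g1 hh; have c2 := regular_pairing_cont g2 hh.
have L1t t := regular_L2 t g1; have L2t t := regular_L2 t g2.
have -> : \int[leb]_(s in `[a, tau]) pairing (fun x => e1 * w1 s x + e2 * w2 s x) h =
   e1 * \int[leb]_(s in `[a, tau]) pairing (w1 s) h + e2 * \int[leb]_(s in `[a, tau]) pairing (w2 s) h.
  rewrite -(int_rayZ _ _ c1)// -(int_rayZ _ _ c2)// -(int_rayD (A := A))//.
  - by apply: eq_Rintegral => s _; rewrite pairingD ?pairingZ//; exact: L2Z.
  - by move=> s As; apply: continuousM; [exact: cvg_cst|exact: c1].
  - by move=> s As; apply: continuousM; [exact: cvg_cst|exact: c2].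
apply: le_trans (ler_normD _ _) _; rewrite !normrM.
apply: le_trans (lerD (ler_wpM2l (normr_ge0 e1) (h1 _ _ St1 hh))
  (ler_wpM2l (normr_ge0 e2) (h2 _ _ St2 hh))) _.
rewrite -mulrDl [leLHS](_ : _ = (`|e1| + `|e2|) / D * (e * tau * nrm h)); last by ring.
rewrite ler_piMl ?mulr_ge0 ?nrm_ge0 ?(ltW e0) ?(ltW (le_lt_trans A0 At))//.
by rewrite ler_pdivrMr// mul1r lerDl.
Qed.

(** The approximating family may be defined on a shorter ray, and need only be
    close to w for large times. *)
Lemma null_average_close A w : 0 <= A -> regular A w ->
  (forall e, 0 < e -> exists w' A' S, [/\ A <= A', regular A' w', null_average A' w' &
     forall s, S < s -> nrm (fun x => w s x - w' s x) <= e]) -> null_average A w.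
Proof.
move=> A0 gw hw; apply: null_average_intro => // e e0; have e2 : 0 < e / 2 by rewrite divr_gt0.
have [w' [A' [S [AA' gw' aw' hS]]]] := hw _ e2.
pose a := Num.max A' S + 1.
have A'a : A' < a by rewrite /a ltr_pwDr// le_max lexx.
have Sa : S < a by rewrite /a ltr_pwDr// le_max lexx orbT.
have [S' hS'] := aw' a A'a _ e2.
have Aa := le_lt_trans AA' A'a.
exists a, (Num.max S' a); split => // tau h; rewrite gt_max => /andP[S't at_] hh.
have g2 := regular_lin 1 (-1) (regular_sub AA' gw) gw'.
have c2 := regular_pairing_cont g2 hh; have c1 := regular_pairing_cont gw' hh.
have -> : \int[leb]_(s in `[a, tau]) pairing (w s) h =
   \int[leb]_(s in `[a, tau]) pairing (w' s) h +
   \int[leb]_(s in `[a, tau]) pairing (fun x => 1 * w s x + -1 * w' s x) h.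
  rewrite -(int_rayD _ c1 c2)//; apply: eq_Rintegral => s _.
  rewrite -pairingD//; [|exact: regular_L2 gw'|exact: regular_L2 g2].
  by congr pairing; apply/funext => x; ring.
have h0 := nrm_ge0 mu h.
have b2 := int_ray_bound c2 A'a (ltW at_) (B := e / 2 * nrm h).
apply: le_trans (ler_normD _ _) _; apply: le_trans (lerD (hS' _ _ S't hh) (b2 _)) _.
  move=> s /andP[as_ _]; apply: le_trans (cauchy_schwarz (regular_L2 s g2) hh) _.
  rewrite ler_wpM2r// -(nrm_eq mu (f := fun x => w s x - w' s x)).
    by apply: hS; exact: lt_le_trans as_.
  by move=> x; ring.
have a0 : 0 <= a by exact: le_trans A0 (ltW Aa).
have : 0 <= e / 2 * nrm h * a by rewrite !mulr_ge0// ltW.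
lra.
Qed.

End Averages.

(** * Replacing moving factors by their means *)

Section SystemAverages.
Context d (X : measurableType d) (R : realType) (mu : probability X R).
Local Notation nrm := (l2norm mu).
Local Notation L2 := (L2 mu).
Local Notation L1 := (L1 mu).
Local Notation leb := (@lebesgue_measure R).
Variables (k l : nat) (T : 'I_k -> 'I_l -> R -> X -> X).
Hypothesis hT : forall i j, measure_preserving_action mu (T i j).
Hypothesis hTc : forall i j, continuous_action mu (T i j).
Hypothesis hTe : forall i j, ergodic_action mu (T i j).
Hypothesis hcomm : forall i i' j j' s s',
     T i j s \o T i' j' s' = T i' j' s' \o T i j s.

Lemma comp_along_eq (J : eqType) (U : J -> R -> X -> X) (r : seq J) a a' :
  {in r, a =1 a'} -> comp_along U r a = comp_along U r a'.
Proof.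
move=> aa; apply/funext => x; elim: r aa => [|j r ih] aa; first by rewrite !comp_along_nil.
rewrite !comp_along_cons aa ?mem_head// ih// => i ir.
by apply: aa; rewrite inE ir orbT.
Qed.

Definition advance (i0 : 'I_k) (j0 : 'I_l) (r : R) (a : 'I_k -> 'I_l -> R) i j :=
  if (i == i0) && (j == j0) then r + a i j else a i j.

(** By commutativity the extra time r of one flow can be applied last. *)
Lemma comp_at_shift i0 j0 r a x :
  comp_at T i0 (advance i0 j0 r a i0) x = T i0 j0 r (comp_at T i0 (a i0) x).
Proof.
rewrite /comp_at; have := mem_index_enum j0; have := index_enum_uniq 'I_l.
elim: (index_enum _) x => [//|j s ih] x /= /andP[js us].
rewrite !comp_along_cons inE {1}/advance eqxx/=; have [jj|j0j] := eqVneq j0 j.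
  subst j0 => _; rewrite (act_add (hT i0 j)) (@comp_along_eq _ (T i0) s _ (a i0))// => i is_.
  rewrite /advance eqxx/=; case: eqP => // ij; move: js.
  by rewrite -ij is_.
move=> /= j0s; rewrite ih//.
by have /(congr1 (fun f => f (comp_along (T i0) s (a i0) x))) := hcomm i0 i0 j j0 (a i0 j) r.
Qed.

Variables (b : 'I_k -> 'I_l -> R) (p : 'I_k -> 'I_l -> R -> R) (A0 : R).
Hypothesis hp : forall i j, admissible (b i j) (p i j).
Hypothesis A00 : 0 <= A0.
Hypothesis bA0 : forall i j, b i j <= A0.

Definition times_at s i j := p i j s.

Lemma times_at_cont i j : cont_ray A0 (fun s => times_at s i j).
Proof.
move=> s As; apply: is_derive_continuous (adm_derive (hp i j) _).
exact: le_lt_trans As.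
Qed.

Lemma moving_prod_regular A M u P (th : R -> 'I_k -> 'I_l -> R) : 1 <= M ->
  (forall i, bdd M (u i)) -> (forall i j, cont_ray A (fun s => th s i j)) ->
  regular mu A (fun s => moving_prod T u P (th s)).
Proof.
move=> M1 hu hth; split.
  by have [N _ hN] := moving_prod_bdd hT P M1 hu; exists N => s; exact: hN.
move=> s As e e0.
have [delta d0 hd] := moving_prod_unif hT hTc hcomm P M1 hu e0.
have : \forall t \near s, forall i j, `|th s i j - th t i j| < delta.
  apply: (@filter_forall _ _ _ (nbhs s) _) => i.
  apply: (@filter_forall _ _ _ (nbhs s) _) => j.
  by have /cvgrPdist_lt := hth i j s As; exact.
by apply: filterS => t ht; apply: hd => i j _; rewrite distrC.
Qed.

Section FixedIndex.
Variables (n : 'I_k) (j0 : 'I_l) (M : R) (u : 'I_k -> X -> R).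
Hypothesis M1 : 1 <= M.
Hypothesis hu : forall i, bdd M (u i).
Hypothesis slow : forall (i : 'I_k) (j : 'I_l), (n < i)%N \/ (i = n /\ j <> j0) ->
  p i j s / p n j0 s @[s --> +oo] --> (0 : R).

(** The product over i >= n in which the n-th function is replaced by z. *)
Definition lead_prod (z : X -> R) (a : 'I_k -> 'I_l -> R) x :=
  z (comp_at T n (a n) x) * moving_prod T u (fun i => (n < i)%N) a x.

Definition replace_lead (z : X -> R) i := if i == n then z else u i.

Lemma lead_prodE z a x : lead_prod z a x = moving_prod T (replace_lead z) (fun i => (n <= i)%N) a x.
Proof.
rewrite /lead_prod /moving_prod [in RHS](bigD1 n)//= /replace_lead.
congr (_ * _); first by rewrite eqxx.
apply: eq_big => [i|i ni]; first by rewrite ltn_neqAle andbC eq_sym.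
by rewrite ifN// neq_ltn ni orbT.
Qed.

Lemma replace_lead_bdd M' z : bdd M' z -> exists2 M'', 1 <= M'' & forall i, bdd M'' (replace_lead z i).
Proof.
move=> hz; exists (Num.max M M'); first by rewrite le_max M1.
move=> i; rewrite /replace_lead.
by case: eqP => _; [apply: (bdd_le _ hz)|apply: (bdd_le _ (hu i))]; rewrite le_max lexx ?orbT.
Qed.

Lemma lead_prod_regular A M' z th : bdd M' z -> (forall i j, cont_ray A (fun s => th s i j)) ->
  regular mu A (fun s => lead_prod z (th s)).
Proof.
move=> hz hth; have [M'' M''1 hup] := replace_lead_bdd hz.
have := moving_prod_regular (fun i : 'I_k => (n <= i)%N) M''1 hup hth.
congr regular; apply/funext => s; apply/funext => x; by rewrite lead_prodE.
Qed.

Lemma lead_prod_unif M' z e : bdd M' z -> 0 < e ->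
  exists2 delta : R, 0 < delta & forall a a' : 'I_k -> 'I_l -> R,
    (forall (i : 'I_k) j, (n <= i)%N -> `|a i j - a' i j| < delta) ->
    nrm (fun x => lead_prod z a x - lead_prod z a' x) <= e.
Proof.
move=> hz e0; have [M'' M''1 hup] := replace_lead_bdd hz.
have [delta d0 hd] := moving_prod_unif hT hTc hcomm (fun i : 'I_k => (n <= i)%N) M''1 hup e0.
exists delta => // a a' /hd; congr (_ <= _).
by apply: nrm_eq => x; rewrite !lead_prodE.
Qed.

Lemma lead_prod_shift z r a x : lead_prod z (advance n j0 r a) x = lead_prod (fun x => z (T n j0 r x)) a x.
Proof.
rewrite /lead_prod comp_at_shift; congr (_ * _); apply: eq_bigr => i ni; congr (u i (comp_at T i _ x)).
by apply/funext => j; rewrite /advance ifN// negb_and neq_ltn ni orbT.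
Qed.

(** Giving the fast flow the extra time r is the same, up to o(1) in norm, as
    advancing all the times from s to sg s: the fast times then agree exactly and
    the slow ones nearly. The pairing with h becomes psi (sg s) - psi s. *)
Lemma coboundary_average M' z r : bdd M' z -> 0 < r ->
  null_average mu A0 (fun s => lead_prod (fun x => z (T n j0 r x) - z x) (times_at s)).
Proof.
move=> hz r0; have [A [sg [A_0 bA hsg csg hshift]]] := shift_average (hp n j0) r0.
have hzr : bdd M' (fun x => z (T n j0 r x)) := mp_bdd (act_mp (hT n j0) r) hz.
have gW := lead_prod_regular (bddB hzr hz) times_at_cont.
apply: null_average_close => // e e0.
have [delta d0 hd] := lead_prod_unif hz e0.
(* On this ray both the times p i j and the shift sg are under control. *)
pose A' := Num.max A0 A.
have AA' : A <= A' by rewrite le_max lexx orbT.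
have A0A' : A0 <= A' by rewrite le_max lexx.
have ptc i j : cont_ray A' (fun s => times_at s i j).
  by move=> s As; apply: times_at_cont; exact: le_lt_trans As.
have ptsgc i j : cont_ray A' (fun s => times_at (sg s) i j).
  move=> s As; apply: continuous_comp; first by apply: csg; exact: le_lt_trans As.
  apply: ptc; have [h _] := hsg s (le_lt_trans AA' As); exact: lt_trans h.
have g1 := lead_prod_regular hz ptc; have g2 := lead_prod_regular hz ptsgc.
have : exists S, forall s, S < s -> forall (i : 'I_k) (j : 'I_l), (n <= i)%N ->
    `|advance n j0 r (times_at s) i j - times_at (sg s) i j| < delta.
  have : \forall s \near +oo, forall (i : 'I_k) (j : 'I_l), (n <= i)%N ->
      `|advance n j0 r (times_at s) i j - times_at (sg s) i j| < delta.
    apply: (@filter_forall _ _ _ (+oo%R : set_system R) _) => i.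
    apply: (@filter_forall _ _ _ (+oo%R : set_system R) _) => j.
    have [ij|ij] := boolP ((i == n) && (j == j0)).
      exists A; split => [|s As _]; first exact: num_real.
      rewrite /advance ij.
      move: ij => /andP[/eqP -> /eqP ->]; have [_ h] := hsg s As.
      by rewrite /times_at h [r + _]addrC subrr normr0.
    have [ni|ni] := leqP n i; last by near=> s.
    have sl : p i j s / p n j0 s @[s --> +oo] --> (0 : R).
      apply: slow; move: ij; rewrite negb_and.
      have [-> /= /eqP|/= nin _] := eqVneq i n; first by right.
      by left; rewrite ltn_neqAle eq_sym nin.
    have [S hS] := slow_increment (hp n j0) (hp i j) sl r0 hsg (divr_gt0 d0 (ltr0n _ 2)).
    exists S; split => [|s Ss _]; first exact: num_real.
    rewrite /advance (negbTE ij) distrC.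
    by apply: le_lt_trans (hS s Ss) _; rewrite ltr_pdivrMr// ltr_pMr// ltr1n.
  by case=> S [_ hS]; exists S.
move=> [S hS].
(* The same comparison family serves for every e, from the time S on. *)
exists (fun s x => 1 * lead_prod z (times_at (sg s)) x + (-1) * lead_prod z (times_at s) x), A', S; split => //.
- exact: regular_lin.
- move=> a A'a e' e'0.
  case: (g1) => -[N hN] _.
  have N0 : 0 <= N := bdd_ge0 (hN 0).
  have N1 : 0 < N + 1 by rewrite ltr_wpDl.
  have [S' hS'] := hshift A' a _ AA' A'a (divr_gt0 e'0 N1).
  exists (Num.max S' a) => tau h; rewrite gt_max => /andP[S't at_] hh.
  have c1 := regular_pairing_cont g1 hh.
  have h0 := nrm_ge0 mu h.
  have bpsi s : A' < s -> `|pairing mu (lead_prod z (times_at s)) h| <= N * nrm h.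
    move=> As; apply: le_trans (cauchy_schwarz (regular_L2 s g1) hh) _.
    by rewrite ler_wpM2r//; exact: nrm_bdd.
  have := hS' tau _ _ S't c1 bpsi.
  have -> : \int[leb]_(s in `[a, tau]) (pairing mu (lead_prod z (times_at (sg s))) h - pairing mu (lead_prod z (times_at s)) h) =
     \int[leb]_(s in `[a, tau]) pairing mu (fun x => 1 * lead_prod z (times_at (sg s)) x + (-1) * lead_prod z (times_at s) x) h.
    apply: eq_Rintegral => s _; have l1 := regular_L2 s g1; have l2 := regular_L2 s g2.
    by rewrite pairingD ?pairingZ ?mul1r ?mulN1r//; exact: L2Z.
  move=> /le_trans; apply.
  have tau0 : 0 <= tau by rewrite (le_trans _ (ltW at_))// (le_trans A00)// (le_trans A0A')// ltW.
  rewrite [leLHS](_ : _ = N / (N + 1) * (e' * tau * nrm h)); last by ring.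
  rewrite ler_piMl ?mulr_ge0 ?(ltW e'0)//.
  by rewrite ler_pdivrMr// mul1r lerDl.
move=> s Ss; apply: le_trans (hd _ _ (hS s Ss)).
rewrite le_eqVlt; apply/orP; left; apply/eqP; apply: nrm_eq => x.
by rewrite lead_prod_shift /lead_prod; ring.
Unshelve. all: by end_near. Qed.

(** For f in the hull of the translates of z, z - f is a combination of
    coboundaries, and f can be chosen with small norm. *)
Lemma meanzero_average z M' : bdd M' z -> \int[mu]_x z x = 0 ->
  null_average mu A0 (fun s => lead_prod z (times_at s)).
Proof.
move=> hz z0; have gz := lead_prod_regular hz times_at_cont.
have key f : hull (T n j0) z f -> null_average mu A0 (fun s => lead_prod (fun x => z x - f x) (times_at s)).
  elim => [r r0|{}f g hf af hg ag].
    have := coboundary_average hz r0.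
    have hzr : bdd M' (fun x => z (T n j0 r x)) := mp_bdd (act_mp (hT n j0) r) hz.
    have gzr := lead_prod_regular (bddB hzr hz) times_at_cont.
    move=> ac; have := null_average_lin (-1) 0 A00 gzr gzr ac ac.
    congr null_average; apply/funext => s; apply/funext => x.
    by rewrite /lead_prod; ring.
  have gf := lead_prod_regular (bddB hz (hull_bdd (hT n j0) hz hf)) times_at_cont.
  have gg := lead_prod_regular (bddB hz (hull_bdd (hT n j0) hz hg)) times_at_cont.
  have := null_average_lin (2^-1) (2^-1) A00 gf gg af ag.
  congr null_average; apply/funext => s; apply/funext => x.
  by rewrite /lead_prod; field.
have [N N1 hN] := moving_prod_bdd hT (fun i : 'I_k => (n < i)%N) M1 hu.
have N0 : 0 < N by exact: lt_le_trans N1.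
apply: null_average_close => // e e0.
have [f hf fe] := mean_ergodic (hT n j0) (@hTe n j0) hz z0 (divr_gt0 e0 N0).
have bf := hull_bdd (hT n j0) hz hf.
exists (fun s => lead_prod (fun x => z x - f x) (times_at s)), A0, A0; split => //.
- exact: lead_prod_regular (bddB hz bf) times_at_cont.
- exact: key.
move=> s _; rewrite (nrm_eq mu (g := fun x => moving_prod T u (fun i => (n < i)%N) (times_at s) x *
    f (comp_at T n (times_at s n) x))); last by move=> x; rewrite /lead_prod; ring.
have Lf := bdd_L2 mu bf; have mt := comp_at_mp hT n (times_at s n).
apply: le_trans (nrm_mulbdd (hN (times_at s)) (mp_L2 mt Lf)) _.
by rewrite (mp_nrm mt Lf) mulrC -ler_pdivlMr.
Qed.

End FixedIndex.

Hypothesis hgrowth : forall (i i' : 'I_k) (j j' : 'I_l),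
     (i' < i)%N \/ (i = i' /\ (j' < j)%N) ->
     p i j s / p i' j' s @[s --> +oo] --> (0 : R).
Hypothesis hl : (0 < l)%N.

(** The factors are replaced by their means one after another, the fastest
    first: the product over i >= m is the one with u m minus its mean as m-th
    function, plus the mean times the product over i > m. *)
Lemma moving_prod_average M u : 1 <= M -> (forall i, bdd M (u i)) ->
  null_average mu A0 (fun s x => moving_prod T u predT (times_at s) x - \prod_(i < k) \int[mu]_x u i x).
Proof.
move=> M1 hu; pose c i := \int[mu]_x u i x.
have gG (m : nat) : regular mu A0 (fun s => moving_prod T u (fun i : 'I_k => (m <= i)%N) (times_at s)).
  exact: moving_prod_regular M1 hu times_at_cont.
have gC (C : R) : regular mu A0 (fun s (x : X) => C).
  split; first by exists `|C| => s; exact: bdd_cst.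
  move=> s _ e e0; apply: (@filterE _ (nbhs s)) => t; rewrite (nrm_eq mu (g := fun=> 0)).
    by rewrite /nrm expr0n/= intC sqrtr0 ltW.
  by move=> x; rewrite subrr.
have main (m' m : nat) : (m + m' = k)%N -> null_average mu A0 (fun s x =>
    moving_prod T u (fun i => (m <= i)%N) (times_at s) x - \prod_(i < k | (m <= i)%N) c i).
  elim: m' m => [|m' ih] m mk.
    have e0 s x : moving_prod T u (fun i => (m <= i)%N) (times_at s) x -
        \prod_(i < k | (m <= i)%N) c i = 0.
      have mi (i : 'I_k) : (m <= i)%N = false.
        by apply/negbTE; rewrite -ltnNge -[m]addn0 mk.
      by rewrite /moving_prod !big_pred0 ?subrr.
    move=> a Aa e e0'; exists a => tau h at_ hh.
    have -> : \int[leb]_(s in `[a, tau]) pairing mu (fun x => moving_prod T u (fun i => (m <= i)%N) (times_at s) x -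
        \prod_(i < k | (m <= i)%N) c i) h = \int[leb]_(s in `[a, tau]) 0.
      apply: eq_Rintegral => s _; rewrite /pairing; under eq_Rintegral do rewrite e0 mul0r.
      by rewrite intC.
    rewrite Rintegral_cst// mul0r normr0 !mulr_ge0 ?nrm_ge0 ?(ltW e0')//.
    by rewrite (le_trans A00)// ltW// (lt_trans Aa).
  have mk' : (m < k)%N by rewrite -mk addnS ltnS leq_addr.
  pose n := Ordinal mk'.
  have {}ih : null_average mu A0 (fun s x => moving_prod T u (fun i => (m < i)%N) (times_at s) x -
      \prod_(i < k | (m < i)%N) c i) by apply: ih; rewrite addSnnS.
  have bz := bddB (hu n) (bdd_cst X (c n)).
  have z0 : \int[mu]_x (u n x - c n) = 0.
    rewrite intB ?intC ?subrr//; first exact: L1_bdd (hu n).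
    exact: L1_cst.
  have slow (i : 'I_k) (j : 'I_l) : (n < i)%N \/ (i = n /\ j <> Ordinal hl) ->
      p i j s / p n (Ordinal hl) s @[s --> +oo] --> (0 : R).
    move=> h; apply: hgrowth; case: h => [|[-> jj]]; [by left|right; split => //=].
    by rewrite lt0n; apply: contra_notN jj => /eqP j00; apply/val_inj.
  have az := meanzero_average M1 hu slow bz z0.
  have gz := lead_prod_regular n M1 hu bz times_at_cont.
  have gi := regular_lin 1 (-1) (gG m.+1) (gC (\prod_(i < k | (m < i)%N) c i)).
  have ai : null_average mu A0 (fun s x => 1 * moving_prod T u (fun i => (m < i)%N) (times_at s) x +
      -1 * \prod_(i < k | (m < i)%N) c i).
    move: ih; congr null_average; apply/funext => s; apply/funext => x; by ring.
  have := null_average_lin 1 (c n) A00 gz gi az ai.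
  congr null_average; apply/funext => s; apply/funext => x.
  rewrite [in RHS](bigD1 n)//= [X in _ = _ - _ * X](_ : _ = \prod_(i < k | (m < i)%N) c i); last first.
    by apply: eq_bigl => i; rewrite ltn_neqAle andbC eq_sym.
  have -> : moving_prod T u (fun i => (m <= i)%N) (times_at s) x = lead_prod n u (u n) (times_at s) x.
    rewrite lead_prodE; apply: eq_bigr => i _; rewrite /replace_lead.
    by case: eqP => // ->.
  by rewrite /lead_prod /=; ring.
exact: (main k 0%N (add0n k)).
Qed.

End SystemAverages.

(** * Complex functions *)

Section ComplexFunctions.
Context d (X : measurableType d) (R : realType) (mu : probability X R).
Local Notation nrm := (l2norm mu).
Local Notation L2 := (L2 mu).
Local Notation L1 := (L1 mu).

(** One Boolean stands for the two parts, so that each argument is made once. *)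
Definition cpart (c : bool) (z : R[i]) : R :=
  if c then complex.Re z else complex.Im z.

Lemma cpartD c z w : cpart c (z + w) = cpart c z + cpart c w.
Proof. by case: c z w => -[? ?] [? ?]. Qed.

Lemma cpartB c z w : cpart c (z - w) = cpart c z - cpart c w.
Proof. by case: c z w => -[? ?] [? ?]. Qed.

Lemma cpart0 c : cpart c 0 = 0.
Proof. by case: c. Qed.

Lemma cpartZ c (r : R) z : cpart c ((r%:C)%C * z) = r * cpart c z.
Proof. by case: c z => -[a e] /=; rewrite mul0r ?subr0 ?addr0. Qed.

Lemma cpartZr c (r : R) z : cpart c (z * (r%:C)%C) = cpart c z * r.
Proof. by rewrite mulrC cpartZ mulrC. Qed.

Lemma cpart_sum I (r : seq I) (P : pred I) c (F : I -> R[i]) :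
  cpart c (\sum_(i <- r | P i) F i) = \sum_(i <- r | P i) cpart c (F i).
Proof. by apply: (big_morph _ (cpartD c) (cpart0 c)). Qed.

Lemma cpart_eta z w : (forall c, cpart c z = cpart c w) -> z = w.
Proof. by case: z w => [a e] [a' e'] h; have /= -> := h true; have /= -> := h false. Qed.

Lemma normc2 z : Normc.normc z ^+ 2 = cpart true z ^+ 2 + cpart false z ^+ 2.
Proof. by case: z => a e; rewrite sqr_sqrtr// addr_ge0// sqr_ge0. Qed.

Lemma normc_ge0 (z : R[i]) : 0 <= Normc.normc z.
Proof. by case: z => a e; exact: sqrtr_ge0. Qed.

Lemma cpart_le_normc c z : `|cpart c z| <= Normc.normc z.
Proof.
rewrite -ler_sqr ?nnegrE ?normc_ge0// real_normK ?num_real// normc2.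
by case: c; rewrite ?lerDl ?lerDr sqr_ge0.
Qed.

Lemma cmeasurableP (f : X -> R[i]) :
  cmeasurable f <-> forall c, measurable_fun [set: X] (fun x => cpart c (f x)).
Proof. by split => [[h1 h2] []//|h]; split; [exact: (h true)|exact: (h false)]. Qed.

(** The L2 norm of a complex function, as a real number. *)
Definition cl2norm (w : X -> R[i]) : R := Num.sqrt
  (nrm (fun x => cpart true (w x)) ^+ 2 + nrm (fun x => cpart false (w x)) ^+ 2).
Local Notation cn := cl2norm.

Lemma cn_sqr w : cn w ^+ 2 = nrm (fun x => cpart true (w x)) ^+ 2 +
  nrm (fun x => cpart false (w x)) ^+ 2.
Proof. by rewrite [LHS]sqr_sqrtr// addr_ge0// sqr_ge0. Qed.

Lemma nrm_le_cn c w : nrm (fun x => cpart c (w x)) <= cn w.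
Proof.
rewrite -ler_sqr ?nnegrE ?nrm_ge0 ?sqrtr_ge0//.
by rewrite cn_sqr; case: c; rewrite ?lerDl ?lerDr sqr_ge0.
Qed.

Lemma cn_le w : cn w <= nrm (fun x => cpart true (w x)) + nrm (fun x => cpart false (w x)).
Proof.
rewrite -ler_sqr ?nnegrE ?addr_ge0 ?nrm_ge0 ?sqrtr_ge0//.
rewrite cn_sqr sqrrD lerD2r lerDl.
by rewrite mulrn_wge0// mulr_ge0 ?nrm_ge0.
Qed.

Lemma cn_ge0 w : 0 <= cn w. Proof. exact: sqrtr_ge0. Qed.

Lemma cLnorm2_pow (w : X -> R[i]) : cLnorm mu 2%:E w =
  ((\int[mu]_x (Normc.normc (w x) ^+ 2)%:E) `^ 2^-1)%E.
Proof.
rewrite /cLnorm unlock; congr (_ `^ _)%E; apply: eq_integral => x _.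
by rewrite abse_EFin poweR_EFin powR_mulrn// ger0_norm ?normc_ge0.
Qed.

Lemma cLnorm2E (w : X -> R[i]) : (forall c, L2 (fun x => cpart c (w x))) ->
  cLnorm mu 2%:E w = (cn w)%:E.
Proof.
move=> hw; have i2 : L1 (fun x => Normc.normc (w x) ^+ 2).
  rewrite (_ : (fun x => _) = fun x => cpart true (w x) ^+ 2 + cpart false (w x) ^+ 2).
    by apply: L1D; [case: (hw true)|case: (hw false)].
  by apply/funext => x; rewrite normc2.
rewrite cLnorm2_pow L1_EFin//; last exact: L1_meas i2.
rewrite poweR_EFin powR12_sqrt; last by apply: Rintegral_ge0 => x _; exact: sqr_ge0.
congr (Num.sqrt _)%:E; rewrite !nrm_sqr -intD; [|by case: (hw true)|by case: (hw false)].
by apply: eq_Rintegral => x _; rewrite normc2.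
Qed.

(** Both parts are dominated by the modulus. *)
Lemma in_Lp2P (w : X -> R[i]) :
  in_Lp mu 2%:E w <-> forall c, L2 (fun x => cpart c (w x)).
Proof.
split => [[/cmeasurableP mw h] c|h]; last first.
  split; last by rewrite cLnorm2E// ltry.
  by apply/cmeasurableP => c; case: (h c).
split; first exact: mw.
have mn : measurable_fun [set: X] (fun x => Normc.normc (w x) ^+ 2).
  rewrite (_ : (fun x => _) = fun x => cpart true (w x) ^+ 2 + cpart false (w x) ^+ 2).
    by apply: measurable_funD; exact: measurable_funX.
  by apply/funext => x; rewrite normc2.
apply: (L1_le (g := fun x => Normc.normc (w x) ^+ 2)).
- exact: measurable_funX.
- apply/integrableP; split; first exact/measurable_EFinP.
  rewrite (eq_integral (fun x => (Normc.normc (w x) ^+ 2)%:E)); last first.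
    by move=> x _ /=; rewrite ger0_norm ?sqr_ge0.
  by move: h; rewrite cLnorm2_pow; apply: lty_poweRy; rewrite invr_neq0.
- move=> x; rewrite ger0_norm ?sqr_ge0// -(real_normK (num_real (cpart c (w x)))).
  by rewrite lerXn2r ?nnegrE ?normc_ge0//; exact: cpart_le_normc.
Qed.

Lemma cmeasurable_prod I (r : seq I) (F : I -> X -> R[i]) :
  (forall i, cmeasurable (F i)) -> cmeasurable (fun x => \prod_(i <- r) F i x).
Proof.
move=> hF; elim: r => [|i r [m1 m2]].
  rewrite (_ : (fun x => _) = fun=> 1); last by apply/funext => x; rewrite big_nil.
  by split; exact: measurable_cst.
rewrite (_ : (fun x => _) = fun x => F i x * \prod_(j <- r) F j x); last first.
  by apply/funext => x; rewrite big_cons.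
have [f1 f2] := hF i.
split.
  rewrite (_ : (fun x => _) = fun x => complex.Re (F i x) * complex.Re (\prod_(j <- r) F j x) -
     complex.Im (F i x) * complex.Im (\prod_(j <- r) F j x)).
    by apply: measurable_funB; apply: measurable_funM.
  by apply/funext => x; case: (F i x) => ? ?; case: (\prod_(j <- r) F j x).
rewrite (_ : (fun x => _) = fun x => complex.Re (F i x) * complex.Im (\prod_(j <- r) F j x) +
     complex.Im (F i x) * complex.Re (\prod_(j <- r) F j x)).
  by apply: measurable_funD; apply: measurable_funM.
by apply/funext => x; case: (F i x) => ? ?; case: (\prod_(j <- r) F j x).
Qed.

(** Elements of L^oo are only essentially bounded; clamping provides
    representatives that are bounded everywhere. *)
Definition clamp (M y : R) := Num.max (- M) (Num.min M y).

Lemma clamp_bdd M g : 0 <= M -> measurable_fun [set: X] g ->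
  bdd M (fun x => clamp M (g x)).
Proof.
move=> M0 mg; split.
  by apply: (measurable_maxr (f := fun=> - M)) => //; apply: (measurable_minr (f := fun=> M)).
move=> x; rewrite ler_norml /clamp le_max lexx/= ge_max ge_min lexx andbT.
by rewrite (le_trans _ M0)// oppr_le0.
Qed.

Lemma clamp_id M y : `|y| <= M -> clamp M y = y.
Proof. by rewrite ler_norml /clamp => /andP[h1 h2]; rewrite (min_idPr h2) (max_idPr h1). Qed.

Lemma in_Lpoo_bound (f : X -> R[i]) : in_Lp mu +oo%E f ->
  exists M, \forall x \ae mu, Normc.normc (f x) <= M.
Proof.
case=> _; rewrite /cLnorm unlock /= probability_setT lte01 => h.
have ge := ess_sup_ge mu (abse \o (fun x => (Normc.normc (f x))%:E)).
case: (ess_sup _ _) h ge => [M _ ge|//|_ ge].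
  exists M; apply: filterS ge => x /=; rewrite lee_fin ger0_norm//; exact: normc_ge0.
by exists 0; apply: filterS ge => x /=.
Qed.

End ComplexFunctions.

(** * Real and imaginary parts of the integrand *)

Section SumsOfAverages.
Context d (X : measurableType d) (R : realType) (mu : probability X R).

Lemma regular_sum (E : Type) (r : seq E) A (al : E -> R) (w : E -> R -> X -> R) :
  (forall e, regular mu A (w e)) -> regular mu A (fun s x => \sum_(e <- r) al e * w e s x).
Proof.
move=> gw; elim: r => [|e r ih].
  rewrite (_ : (fun s => _) = fun s x => 0); last first.
    by apply/funext => s; apply/funext => x; rewrite big_nil.
  split; first by exists `|0 : R| => s; exact: bdd_cst.
  move=> s _ e e0; apply: (@filterE _ (nbhs s)) => t; rewrite (nrm_eq mu (g := fun=> 0)).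
    by rewrite /l2norm expr0n/= intC sqrtr0 ltW.
  by move=> x; rewrite subrr.
rewrite (_ : (fun s => _) = fun s x => al e * w e s x + 1 * \sum_(e <- r) al e * w e s x).
  exact: regular_lin.
by apply/funext => s; apply/funext => x; rewrite big_cons mul1r.
Qed.

Lemma null_average_sum (E : Type) (r : seq E) A (al : E -> R) (w : E -> R -> X -> R) :
  0 <= A -> (forall e, regular mu A (w e)) -> (forall e, null_average mu A (w e)) ->
  null_average mu A (fun s x => \sum_(e <- r) al e * w e s x).
Proof.
move=> A0 gw aw; elim: r => [|e r ih].
  move=> a Aa e e0; exists a => tau h at_ hh.
  have -> : \int[@lebesgue_measure R]_(s in `[a, tau])
      pairing mu (fun x => \sum_(e <- [::]) al e * w e s x) h =
      \int[@lebesgue_measure R]_(s in `[a, tau]) 0.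
    apply: eq_Rintegral => s _; rewrite /pairing; under eq_Rintegral do rewrite big_nil mul0r.
    by rewrite intC.
  rewrite Rintegral_cst// mul0r normr0 !mulr_ge0 ?nrm_ge0 ?(ltW e0)//.
  by rewrite (le_trans A0)// ltW// (lt_trans Aa).
have := null_average_lin (al e) 1 A0 (gw e) (regular_sum r al gw) (aw e) ih.
congr null_average; apply/funext => s; apply/funext => x; by rewrite big_cons mul1r.
Qed.

(** The preimage of a null set is null. *)
Lemma mp_ae (T : X -> X) (P : X -> Prop) : measure_preserving mu T ->
  (\forall y \ae mu, P y) -> \forall x \ae mu, P (T x).
Proof.
move=> [mT hT] [N [mN N0 PN]]; exists (T @^-1` N); split.
- by rewrite -[_ @^-1` _]setTI; exact: mT.
- by rewrite hT.
- by move=> x /= h; apply: PN.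
Qed.

End SumsOfAverages.

Section IntegrandParts.
Context d (X : measurableType d) (R : realType) (mu : probability X R).
Variables (k l : nat) (T : 'I_k -> 'I_l -> R -> X -> X).
Hypothesis hT : forall i j, measure_preserving_action mu (T i j).
Variables (p : 'I_k -> 'I_l -> R -> R) (f : 'I_k -> X -> R[i]).
Hypothesis hf : forall i, in_Lp mu +oo%E (f i).

Lemma bounded_parts : exists M (v : 'I_k -> bool -> X -> R), [/\ 1 <= M,
  (forall i c, bdd M (v i c)) &
  forall i, \forall x \ae mu, forall c, cpart c (f i x) = v i c x].
Proof.
have /choice[B hB] : forall i, exists M, \forall x \ae mu, Normc.normc (f i x) <= M.
  by move=> i; exact: in_Lpoo_bound (hf i).
pose M := 1 + \sum_(i < k) `|B i|.
have BM i : B i <= M.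
  rewrite /M (bigD1 i)//= addrCA (le_trans (ler_norm _))// lerDl addr_ge0//.
  by apply: sumr_ge0.
have M1 : 1 <= M by rewrite lerDl; apply: sumr_ge0.
exists M, (fun i c x => clamp M (cpart c (f i x))); split => //.
  move=> i c; apply: clamp_bdd; first exact: le_trans M1.
  by have [/cmeasurableP h _] := hf i; exact: h.
move=> i; apply: filterS (hB i) => x hx c; rewrite clamp_id//.
by apply: le_trans (cpart_le_normc _ _) (le_trans hx (BM i)).
Qed.

Lemma integrand_cmeasurable s : cmeasurable (integrand T p f s).
Proof.
apply: cmeasurable_prod => i; have [[m1 m2] _] := hf i.
have mt := comp_at_mp hT i (fun j => p i j s).
by split; [exact: (mp_meas mt m1)|exact: (mp_meas mt m2)].
Qed.

(** The factor i from each selected imaginary part when the product of the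
    Re f i + i Im f i is expanded; e selects the parts. *)
Definition phase (e : {ffun 'I_k -> bool}) : R[i] :=
  \prod_(i < k) (if e i then 1 else Complex 0 1).

Lemma prod_parts c (z : 'I_k -> R[i]) : cpart c (\prod_(i < k) z i) =
  \sum_(e : {ffun 'I_k -> bool}) cpart c (phase e) * \prod_(i < k) cpart (e i) (z i).
Proof.
rewrite (eq_bigr (fun i => \sum_(b : bool)
    (if b then 1 else Complex 0 1) * ((cpart b (z i))%:C)%C)); last first.
  move=> i _; rewrite big_bool /= mul1r; case: (z i) => a b /=.
  by apply: cpart_eta => -[] /=; rewrite ?(mul0r, mul1r, mulr0, subr0, addr0, add0r).
rewrite bigA_distr_bigA cpart_sum; apply: eq_bigr => e _.
rewrite big_split/= -(rmorph_prod (real_complex R)) -cpartZr.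
by [].
Qed.

Variables (M : R) (v : 'I_k -> bool -> X -> R).
Hypothesis M1 : 1 <= M.
Hypothesis hv : forall i c, bdd M (v i c).
Hypothesis fv : forall i, \forall x \ae mu, forall c, cpart c (f i x) = v i c x.

Definition integrand_part c s x := \sum_(e : {ffun 'I_k -> bool})
  cpart c (phase e) * moving_prod T (fun i => v i (e i)) predT (times_at p s) x.

(** The null set depends on s. This is harmless, since the integrand is only
    used through its pairings at fixed times. *)
Lemma integrand_ae s : \forall x \ae mu, forall c,
  cpart c (integrand T p f s x) = integrand_part c s x.
Proof.
have : \forall x \ae mu, forall i c, cpart c (f i (comp_at T i (times_at p s i) x)) =
    v i c (comp_at T i (times_at p s i) x).
  apply: filter_forall => i; exact: (mp_ae (comp_at_mp hT i (times_at p s i)) (fv i)).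
apply: filterS => x hx c; rewrite /integrand prod_parts; apply: eq_bigr => e _.
by congr (_ * _); apply: eq_bigr => i _; rewrite -hx.
Qed.

Lemma cintegral_parts c : cpart c (\prod_(i < k) cintegral mu (f i)) =
  \sum_(e : {ffun 'I_k -> bool}) cpart c (phase e) * \prod_(i < k) \int[mu]_x v i (e i) x.
Proof.
rewrite prod_parts; apply: eq_bigr => e _; congr (_ * _); apply: eq_bigr => i _.
rewrite /cintegral.
have -> : cpart (e i) (Complex (\int[mu]_x complex.Re (f i x)) (\int[mu]_x complex.Im (f i x)))
  = \int[mu]_x cpart (e i) (f i x) by case: (e i).
apply: int_ae; first by have [/cmeasurableP h _] := hf i; exact: h.
- by have [] := hv i (e i).
- by apply: filterS (fv i) => x ->.
Qed.

Hypothesis hTc : forall i j, continuous_action mu (T i j).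
Hypothesis hcomm : forall i i' j j' s s',
     T i j s \o T i' j' s' = T i' j' s' \o T i j s.
Variables (b : 'I_k -> 'I_l -> R).
Hypothesis hp : forall i j, admissible (b i j) (p i j).

Lemma integrand_part_regular A c : (forall i j, b i j <= A) -> regular mu A (integrand_part c).
Proof.
move=> bA; apply: regular_sum => e.
exact: (moving_prod_regular hT hTc hcomm predT M1 (fun i => hv i (e i)) (fun i j => @times_at_cont _ _ _ _ _ _ hp bA i j)).
Qed.

Hypothesis hTe : forall i j, ergodic_action mu (T i j).
Hypothesis hgrowth : forall (i i' : 'I_k) (j j' : 'I_l),
     (i' < i)%N \/ (i = i' /\ (j' < j)%N) ->
     p i j s / p i' j' s @[s --> +oo] --> (0 : R).
Hypothesis hl : (0 < l)%N.

Lemma integrand_part_average A c : 0 <= A -> (forall i j, b i j <= A) ->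
  null_average mu A (fun s x => integrand_part c s x - cpart c (\prod_(i < k) cintegral mu (f i))).
Proof.
move=> A0 bA.
have av (e : {ffun 'I_k -> bool}) := moving_prod_average hT hTc (fun i j B => @hTe i j B) hcomm hp A0 bA hgrowth hl M1
  (fun i => hv i (e i)).
have gw (e : {ffun 'I_k -> bool}) : regular mu A (fun s x =>
    moving_prod T (fun i => v i (e i)) predT (times_at p s) x - \prod_(i < k) \int[mu]_x v i (e i) x).
  have g1 : regular mu A (fun s => moving_prod T (fun i => v i (e i)) predT (times_at p s)).
    exact: (moving_prod_regular hT hTc hcomm predT M1 (fun i => hv i (e i)) (fun i j => @times_at_cont _ _ _ _ _ _ hp bA i j)).
  case: g1 => -[N hN] g1; split.
    by eexists => s; apply: bddB (hN s) (bdd_cst _ _).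
  move=> s As e1 e10; apply: filterS (g1 s As e1 e10) => t.
  by congr (_ <= _); apply: nrm_eq => x; ring.
have := null_average_sum (index_enum _) (fun e => cpart c (phase e)) A0 gw av.
congr null_average; apply/funext => s; apply/funext => x.
rewrite cintegral_parts /integrand_part -sumrB; apply: eq_bigr => e _; by rewrite mulrBr.
Qed.

End IntegrandParts.

(** * Weak description of the Bochner integral *)

Lemma cvge0_near_lt (R : realType) (T : Type) (Fl : set_system T) (u : T -> \bar R) (e : R) :
  u @ Fl --> 0%E -> 0 < e -> \forall n \near Fl, (u n < e%:E)%E.
Proof.
move=> hu e0; apply: (hu [set y | (y < e%:E)%E]).
by apply: open_nbhs_nbhs; split; [exact: open_ereal_lt_ereal|rewrite /= lte_fin].
Qed.

Lemma Rintegral_sum d (X : measurableType d) (R : realType) (m : {measure set X -> \bar R})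
    (D : set X) I (r : seq I) (g : I -> X -> R) : measurable D ->
  (forall i, m.-integrable D (EFin \o g i)) ->
  m.-integrable D (EFin \o (fun s => \sum_(i <- r) g i s)) /\
  \int[m]_(s in D) (\sum_(i <- r) g i s) = \sum_(i <- r) \int[m]_(s in D) g i s.
Proof.
move=> mD ig; elim: r => [|i r [ih1 ih2]].
  rewrite (_ : (fun s => _) = fun=> 0); last by apply/funext => x; rewrite big_nil.
  by rewrite big_nil; split; [exact: integrable0|rewrite /Rintegral integral0].
rewrite (_ : (fun s => _) = fun s => g i s + \sum_(i <- r) g i s); last first.
  by apply/funext => x; rewrite big_cons.
split; first exact: (integrableD mD (ig i) ih1).
by rewrite RintegralD// big_cons ih2.
Qed.

Section Bochner.
Context d (X : measurableType d) (R : realType) (mu : probability X R).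
Local Notation nrm := (l2norm mu).
Local Notation L2 := (L2 mu).
Local Notation L1 := (L1 mu).
Local Notation pr := (pairing mu).
Local Notation cn := (cl2norm mu).
Local Notation leb := (@lebesgue_measure R).

Lemma L2_ae (f g : X -> R) : measurable_fun [set: X] f -> L2 g ->
  (\forall x \ae mu, f x = g x) -> L2 f.
Proof.
move=> mf [mg /integrableP[mg2 ig]] fg; split => //; apply/integrableP; split.
  exact/measurable_EFinP/measurable_funX.
apply: le_lt_trans ig; rewrite le_eqVlt; apply/orP; left; apply/eqP.
apply: ae_eq_integral => //.
- by apply: measurableT_comp => //; apply/measurable_EFinP/measurable_funX.
- exact: measurableT_comp.
- by apply: filterS fg => x /= ->.
Qed.

Lemma pairing_sum I (r : seq I) (al : I -> R) (w : I -> X -> R) h :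
  (forall i, L2 (w i)) -> L2 h ->
  pr (fun x => \sum_(i <- r) al i * w i x) h = \sum_(i <- r) al i * pr (w i) h.
Proof.
move=> hw hh; elim: r => [|i r ih].
  by rewrite big_nil /pr; under eq_Rintegral do rewrite big_nil mul0r; rewrite intC.
rewrite big_cons -ih -pairingZ// -pairingD//.
- by congr pairing; apply/funext => x; rewrite big_cons.
- exact: L2Z.
- by apply: L2_sum => j _; exact: L2Z.
Qed.

Section SimpleFunctions.
Variables (S : L2_simple mu).

Lemma scoef_cpart_L2 (m : 'I_(ssize S)) c : L2 (fun x => cpart c (scoef m x)).
Proof. by move: c; apply/in_Lp2P; exact: scoef_L2. Qed.

Lemma cpart_simple_fun c s x : cpart c (simple_fun S s x) =
  \sum_(m < ssize S) (\1_(sset m) s : R) * cpart c (scoef m x).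
Proof. by rewrite cpart_sum; apply: eq_bigr => m _; rewrite cpartZ. Qed.

Lemma cpart_simple_integral c D x : cpart c (simple_integral D S x) =
  \sum_(m < ssize S) fine (leb (sset m `&` D)) * cpart c (scoef m x).
Proof. by rewrite cpart_sum; apply: eq_bigr => m _; rewrite cpartZ. Qed.

Lemma simple_fun_L2 c s : L2 (fun x => cpart c (simple_fun S s x)).
Proof.
rewrite (_ : (fun x => _) = fun x => \sum_(m < ssize S) (\1_(sset m) s : R) * cpart c (scoef m x)).
  by apply: L2_sum => m _; apply: L2Z; exact: scoef_cpart_L2.
by apply/funext => x; rewrite cpart_simple_fun.
Qed.

Lemma simple_integral_L2 c D : L2 (fun x => cpart c (simple_integral D S x)).
Proof.
rewrite (_ : (fun x => _) = fun x => \sum_(m < ssize S) fine (leb (sset m `&` D)) * cpart c (scoef m x)).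
  by apply: L2_sum => m _; apply: L2Z; exact: scoef_cpart_L2.
by apply/funext => x; rewrite cpart_simple_integral.
Qed.

Lemma simple_integral_pr c D h : measurable D -> (leb D < +oo)%E -> L2 h ->
  leb.-integrable D (EFin \o (fun s => pr (fun x => cpart c (simple_fun S s x)) h)) /\
  pr (fun x => cpart c (simple_integral D S x)) h =
  \int[leb]_(s in D) pr (fun x => cpart c (simple_fun S s x)) h.
Proof.
move=> mD finD hh; pose al (m : 'I_(ssize S)) := pr (fun x => cpart c (scoef m x)) h.
have E s : pr (fun x => cpart c (simple_fun S s x)) h =
    \sum_(m < ssize S) al m * (\1_(sset m) s : R).
  under eq_bigr do rewrite mulrC.
  rewrite -pairing_sum//; last by move=> m; exact: scoef_cpart_L2.
  by congr pairing; apply/funext => x; rewrite cpart_simple_fun.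
have ii (m : 'I_(ssize S)) : leb.-integrable D (EFin \o (\1_(sset m) : R -> R)).
  apply: measurable_bounded_integrable => //.
    by apply: measurable_indic; exact: sset_measurable.
  exists 1; split; first exact: num_real.
  move=> M M1 s _ /=; rewrite indicE; apply: le_trans (ltW M1).
  by case: (_ \in _); rewrite ?normr1 ?normr0.
have iia (m : 'I_(ssize S)) : leb.-integrable D (EFin \o (fun s => al m * (\1_(sset m) s : R))).
  exact: (integrableZl mD (al m) (ii m)).
have [h1 h2] := Rintegral_sum (index_enum 'I_(ssize S)) mD iia.
under [X in leb.-integrable _ (EFin \o X)]eq_fun do rewrite E.
split => //.
under [RHS]eq_Rintegral do rewrite E.
rewrite h2.
have -> : pr (fun x => cpart c (simple_integral D S x)) h =
    \sum_(m < ssize S) fine (leb (sset m `&` D)) * al m.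
  rewrite -pairing_sum//; last by move=> m; exact: scoef_cpart_L2.
  by congr pairing; apply/funext => x; rewrite cpart_simple_integral.
apply: eq_bigr => m _; rewrite RintegralZl// mulrC; congr (_ * _).
by rewrite /Rintegral integral_indic//; exact: sset_measurable.
Qed.

End SimpleFunctions.

Variables (A1 : R) (F : R -> X -> R[i]) (Fc : bool -> R -> X -> R).
Hypothesis hFm : forall s, cmeasurable (F s).
Hypothesis hFae : forall s, \forall x \ae mu, forall c, cpart c (F s x) = Fc c s x.
Hypothesis hgood : forall c, regular mu A1 (Fc c).

Definition window tau : set R := [set s | 0 <= s <= tau /\ A1 < s].

Lemma windowE tau : window tau = `[0, tau] `&` `]A1, +oo[.
Proof. by apply/seteqP; split => s; rewrite /window /= !in_itv/= andbT. Qed.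

Lemma window_meas tau : measurable (window tau).
Proof. by rewrite windowE; exact: measurableI. Qed.

Lemma window_fin tau : (leb (window tau) < +oo)%E.
Proof.
apply: le_lt_trans (_ : (leb `[0%R, tau] < +oo)%E).
  by apply: le_measure; rewrite ?inE//; [exact: window_meas|rewrite windowE; exact: subIsetl].
by rewrite lebesgue_measure_itv/=; case: ifP => _; rewrite ?ltry// lte_add_pinfty ?ltry.
Qed.

Lemma ray_window_meas tau g : cont_ray A1 g -> measurable_fun (window tau) g.
Proof.
move=> cg; apply: subspace_continuous_measurable_fun; first exact: window_meas.
by apply: continuous_in_subspaceT => s; rewrite inE => -[_ A1s]; exact: cg.
Qed.

Lemma ray_window_int tau g B : cont_ray A1 g -> (forall s, A1 < s -> `|g s| <= B) ->
  leb.-integrable (window tau) (EFin \o g).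
Proof.
move=> cg bg; apply: measurable_bounded_integrable.
- exact: window_meas.
- exact: window_fin.
- exact: ray_window_meas.
exists B; split; first exact: num_real.
by move=> M BM s [_ A1s] /=; apply: le_trans (ltW BM); exact: bg.
Qed.

Lemma F_meas c s : measurable_fun [set: X] (fun x => cpart c (F s x)).
Proof. by have /cmeasurableP := hFm s; exact. Qed.

Lemma F_L2 c s : L2 (fun x => cpart c (F s x)).
Proof.
apply: L2_ae (F_meas c s) (regular_L2 s (hgood c)) _.
by apply: filterS (hFae s) => x; exact.
Qed.

Lemma F_in_Lp s : in_Lp mu 2%:E (F s).
Proof. by apply/in_Lp2P => c; exact: F_L2. Qed.

Lemma F_pr c s h : L2 h -> pr (fun x => cpart c (F s x)) h = pr (Fc c s) h.
Proof.
move=> [mh _]; have [mg _] := regular_L2 s (hgood c); apply: int_ae.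
- by apply: measurable_funM => //; exact: F_meas.
- exact: measurable_funM.
- by apply: filterS (hFae s) => x ->.
Qed.

Lemma Fc_pr_int tau c h : L2 h ->
  leb.-integrable (window tau) (EFin \o (fun s => pr (Fc c s) h)).
Proof.
move=> hh; have [[N hN] _] := hgood c.
apply: (@ray_window_int _ _ (N * nrm h)); first exact: regular_pairing_cont (hgood c) hh.
move=> s _; apply: le_trans (cauchy_schwarz (regular_L2 s (hgood c)) hh) _.
by rewrite ler_wpM2r ?nrm_ge0//; exact: nrm_bdd.
Qed.

Lemma simple_errorE (S : L2_simple mu) s : simple_error F S s = (cn (fun x => F s x - simple_fun S s x))%:E.
Proof.
apply: cLnorm2E => c; under [X in L2 X]eq_fun do rewrite cpartB.
by apply: L2B; [exact: F_L2|exact: simple_fun_L2].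
Qed.

(** A simple function close to F in the Bochner sense has nearly the same weak
    integral. This yields both the weak description of Bochner integrals and the
    Cauchy property of approximating sequences. *)
Lemma simple_pairing tau (S : L2_simple mu) c h : L2 h -> measurable_fun (window tau) (simple_error F S) ->
  (`|pr (fun x => cpart c (simple_integral (window tau) S x)) h -
     \int[leb]_(s in window tau) pr (Fc c s) h|%:E
   <= (nrm h)%:E * \int[leb]_(s in window tau) simple_error F S s)%E.
Proof.
move=> hh me; have mD := window_meas tau.
have [i1 ->] := simple_integral_pr S c mD (window_fin tau) hh.
have i2 := Fc_pr_int tau c hh.
have i3 : leb.-integrable (window tau) (EFin \o (fun s =>
    pr (fun x => cpart c (simple_fun S s x)) h - pr (Fc c s) h)).
  exact: (@integrableB _ _ R leb (window tau) mD _ _ i1 i2).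
rewrite -RintegralB// EFin_normr_Rintegral//.
apply: le_trans (le_abse_integral leb mD (measurable_int _ i3)) _.
have h0 := nrm_ge0 mu h.
rewrite -ge0_integralZl//; last by move=> s _; rewrite simple_errorE lee_fin cn_ge0.
apply: ge0_le_integral => //.
- by apply: measurableT_comp => //; exact: measurable_int i3.
- by apply: measurable_funeM.
move=> s Ds; rewrite simple_errorE /= lee_fin -F_pr// -pairingB//; [|exact: simple_fun_L2|exact: F_L2].
apply: le_trans (cauchy_schwarz (L2B (simple_fun_L2 S c s) (F_L2 c s)) hh) _.
rewrite mulrC ler_wpM2l// nrmBC.
rewrite -(nrm_eq mu (f := fun x => cpart c (F s x - simple_fun S s x))).
  exact: nrm_le_cn.
by move=> x; rewrite cpartB.
Qed.

(** The family Fc has the same pairings as F but is continuous in time. *)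
Lemma bochner_pairing tau G c h : is_bochner_integral mu (window tau) F G -> L2 h ->
  pr (fun x => cpart c (G x)) h = \int[leb]_(s in window tau) pr (Fc c s) h.
Proof.
move=> [_ /in_Lp2P GL2 [S [mS cS cG]]] hh; apply/eqP; rewrite -subr_eq0 -normr_eq0.
rewrite eq_le normr_ge0 andbT; apply/ler_addgt0Pl => e e0; rewrite addr0.
have h0 := nrm_ge0 mu h; pose C := 2 * nrm h + 1.
have C0 : 0 < C by rewrite /C ltr_wpDl// mulr_ge0.
have eC : 0 < e / C by exact: divr_gt0.
have [N _ hN] := cvge0_near_lt cS eC; have [N' _ hN'] := cvge0_near_lt cG eC.
pose n := maxn N N'.
have {}hN := hN n (leq_maxl _ _); have {}hN' := hN' n (leq_maxr _ _).
set I := \int[leb]_(s in window tau) pr (Fc c s) h.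
have SL2 := simple_integral_L2 (S n) c (window tau).
have k1 : `|pr (fun x => cpart c (simple_integral (window tau) (S n) x)) h - I| <= nrm h * (e / C).
  rewrite -lee_fin; apply: le_trans (simple_pairing c hh (mS n)) _.
  by rewrite EFinM lee_wpmul2l ?lee_fin// ltW.
have k2 : `|pr (fun x => cpart c (G x)) h - pr (fun x => cpart c (simple_integral (window tau) (S n) x)) h|
    <= nrm h * (e / C).
  rewrite -pairingB//; apply: le_trans (cauchy_schwarz (L2B (GL2 c) SL2) hh) _.
  rewrite mulrC ler_wpM2l//.
  move: hN' => /=; rewrite cLnorm2E => [|c']; last first.
    under [X in L2 X]eq_fun do rewrite cpartB.
    by apply: L2B => //; exact: simple_integral_L2.
  rewrite lte_fin => /ltW; apply: le_trans.
  rewrite -(nrm_eq mu (f := fun x => cpart c (G x - simple_integral (window tau) (S n) x))).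
    exact: nrm_le_cn.
  by move=> x; rewrite cpartB.
have := lerD k2 k1; move=> /(le_trans (ler_normD _ _)).
rewrite addrA subrK => /le_trans; apply.
rewrite -mulrDl mulrCA -[leRHS]mulr1 ler_wpM2l ?(ltW e0)// ler_pdivrMr// mul1r.
by rewrite /C; lra.
Qed.

End Bochner.

(** * From weak averages to norm convergence *)

Section BochnerLimit.
Context d (X : measurableType d) (R : realType) (mu : probability X R).
Local Notation nrm := (l2norm mu).
Local Notation L2 := (L2 mu).
Local Notation pr := (pairing mu).
Local Notation cn := (cl2norm mu).
Local Notation leb := (@lebesgue_measure R).
Variables (A1 : R) (F : R -> X -> R[i]) (Fc : bool -> R -> X -> R).
Hypothesis hFm : forall s, cmeasurable (F s).
Hypothesis hFae : forall s, \forall x \ae mu, forall c, cpart c (F s x) = Fc c s x.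
Hypothesis hgood : forall c, regular mu A1 (Fc c).

Lemma limit_estimate (a tau n I1 I2 P N K e : R) : 0 <= n -> 0 < a ->
  I1 <= N * n * a -> I2 <= e / 2 * tau * n -> - (K * n) <= P ->
  2 * (N + K) * a < tau * e -> I1 + (I2 + (tau - a) * P) - tau * P <= tau * (e * n).
Proof.
move=> n0 a0 h1 h2 h3 h4.
have h5 : (N + K) * a * n <= e * tau / 2 * n by rewrite ler_wpM2r//; lra.
have h6 : a * - (K * n) <= a * P by rewrite ler_pM2l.
lra.
Qed.

Lemma pairing_self h : pr h h = nrm h ^+ 2.
Proof. by rewrite nrm_sqr; apply: eq_Rintegral => x _; rewrite expr2. Qed.

Lemma nrm_le_pr h B : 0 <= B -> nrm h ^+ 2 <= B * nrm h -> nrm h <= B.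
Proof.
move=> B0; have [->//|h0] := eqVneq (nrm h) 0.
by rewrite expr2 ler_pM2r// lt0r h0 nrm_ge0.
Qed.

Lemma window_mass a : 0 <= a -> fine (leb (window A1 a)) <= a.
Proof.
move=> a0; rewrite -lee_fin fineK; last first.
  by rewrite ge0_fin_numE//; exact: window_fin.
apply: le_trans (_ : (leb `[0%R, a] <= _)%E).
  by apply: le_measure; rewrite ?inE//; [exact: window_meas|rewrite windowE; exact: subIsetl].
rewrite lebesgue_measure_itv/= lte_fin; case: ifPn => _; last by rewrite lee_fin.
by rewrite oppr0 adde0.
Qed.

Lemma window_split a tau g : 0 <= a -> A1 < a -> a <= tau ->
  leb.-integrable (window A1 tau) (EFin \o g) ->
  \int[leb]_(s in window A1 tau) g s =
  \int[leb]_(s in window A1 a) g s + \int[leb]_(s in `]a, tau]) g s.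
Proof.
move=> a0 Aa at_ ig.
have E : window A1 tau = window A1 a `|` `]a, tau].
  apply/seteqP; split => s; rewrite /window /= in_itv/=.
    move=> [/andP[s0 st] As]; have [sa|as_] := leP s a; first by left; rewrite s0.
    by right; rewrite st.
  move=> [[/andP[s0 sa] As]|/andP[as_ st]]; first by rewrite s0 (le_trans sa).
  by rewrite st (le_trans a0 (ltW as_)) (lt_trans Aa as_).
rewrite E in ig *; rewrite Rintegral_setU//; first exact: window_meas.
by apply/disj_setPS => s [[/andP[_ sa] _]]; rewrite /= in_itv/= ltNge sa.
Qed.

(** The deviation from C serves as its own test function h, so that its squared
    norm is a pairing; the part of the window before A + 1 contributes O(1). *)
Lemma bochner_limit_part (C : R) A c (G : R -> X -> R[i]) : 0 <= A -> A1 <= A ->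
  null_average mu A (fun s x => Fc c s x - C) ->
  (forall tau, is_bochner_integral mu (window A1 tau) F (G tau)) ->
  forall e, 0 < e -> exists S, 0 < S /\ forall tau, S < tau ->
    L2 (fun x => tau^-1 * cpart c (G tau x) - C) /\
    nrm (fun x => tau^-1 * cpart c (G tau x) - C) <= e.
Proof.
move=> A0 A1A av hG e e0; pose a := A + 1.
have Aa : A < a by rewrite ltrDl.
have a0 : 0 < a by exact: le_lt_trans Aa.
have A1a : A1 < a by exact: le_lt_trans Aa.
have e2 : 0 < e / 2 by rewrite divr_gt0.
have [S0 hS0] := av a Aa _ e2.
have gF := hgood c; case: (gF) => -[N hN] _; have N0 := bdd_ge0 (hN 0).
exists (Num.max (Num.max S0 a) (2 * (N + `|C|) * a / e)).
split; first by rewrite !lt_max a0 orbT.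
move=> tau; rewrite !gt_max => /andP[/andP[St at_] et].
have tau0 : 0 < tau by exact: lt_trans at_.
have [_ /in_Lp2P GL2 _] := hG tau.
pose h x := tau^-1 * cpart c (G tau x) - C.
have hh : L2 h by apply: L2B; [exact: L2Z|exact: L2_cst].
split => //; rewrite -/h; apply: nrm_le_pr; first exact: ltW.
have h0 := nrm_ge0 mu h.
have gF' : regular mu A (Fc c) := regular_sub A1A gF.
have gC : regular mu A (fun s (x : X) => C).
  split; first by exists `|C| => s; exact: bdd_cst.
  move=> s _ e1 e10; apply: (@filterE _ (nbhs s)) => t; rewrite (nrm_eq mu (g := fun=> 0)).
    by rewrite /nrm expr0n/= intC sqrtr0 ltW.
  by move=> x; rewrite subrr.
have prC : `|pr (fun=> C) h| <= `|C| * nrm h.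
  apply: le_trans (cauchy_schwarz (L2_cst mu C) hh) _.
  by rewrite ler_wpM2r//; apply: nrm_bdd; exact: bdd_cst.
have prN s : `|pr (Fc c s) h| <= N * nrm h.
  apply: le_trans (cauchy_schwarz (regular_L2 s gF) hh) _.
  by rewrite ler_wpM2r//; exact: nrm_bdd.
have iD := Fc_pr_int hgood tau c hh.
have iDa := Fc_pr_int hgood a c hh.
have e1 : tau * nrm h ^+ 2 = \int[leb]_(s in window A1 tau) pr (Fc c s) h - tau * pr (fun=> C) h.
  rewrite -(bochner_pairing hFm hFae hgood c (hG tau) hh) -pairing_self {1}/h pairingB//.
    by rewrite pairingZ// mulrBr mulrA divff ?mul1r// gt_eqF.
  - exact: L2Z.
  - exact: L2_cst.
have k1 : `|\int[leb]_(s in window A1 a) pr (Fc c s) h| <= N * nrm h * a.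
  have k0 : `|\int[leb]_(s in window A1 a) pr (Fc c s) h| <=
      \int[leb]_(s in window A1 a) `|pr (Fc c s) h|.
    by apply: le_normr_Rintegral => //; exact: window_meas.
  apply: le_trans k0 _.
  apply: le_trans (_ : \int[leb]_(s in window A1 a) (N * nrm h) <= _).
    apply: le_Rintegral => //; first exact: window_meas.
    - exact: integrable_norm.
    - apply: (@ray_window_int _ A1 a (fun=> N * nrm h) `|N * nrm h|) => //.
      by move=> s _; exact: cvg_cst.
  rewrite Rintegral_cst; last exact: window_meas.
  by rewrite ler_wpM2l ?mulr_ge0//; exact: window_mass (ltW a0).
have cF := regular_pairing_cont gF' hh.
have k2 : \int[leb]_(s in `]a, tau]) pr (Fc c s) h =
    \int[leb]_(s in `[a, tau]) pr (fun x => Fc c s x - C) h + (tau - a) * pr (fun=> C) h.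
  have ii := cont_ray_integrable tau cF Aa.
  rewrite Rintegral_itv_obnd_cbnd; last first.
    by apply: integrableS ii => //; apply: subset_itv; rewrite bnd_simp.
  have -> : (tau - a) * pr (fun=> C) h = \int[leb]_(s in `[a, tau]) pr (fun=> C) h.
    rewrite Rintegral_cst//= lebesgue_measure_itv/= lte_fin at_ mulrC.
    by congr (_ * _).
  have gL := regular_lin 1 (-1) gF' gC.
  rewrite -(int_rayD (A := A))//.
  - apply: eq_Rintegral => s _; rewrite -pairingD//; [|apply: L2B => //|]; last 2 first.
    + exact: L2_cst.
    + exact: L2_cst.
    + by congr pairing; apply/funext => x; rewrite subrK.
    + exact: regular_L2 gF.
  - have := regular_pairing_cont gL hh; congr cont_ray; apply/funext => s.
    by congr pairing; apply/funext => x; rewrite mul1r mulN1r.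
  - by move=> s _; exact: cvg_cst.
have k3 := hS0 tau h St hh.
have dsp := window_split (ltW a0) A1a (ltW at_) iD.
rewrite dsp k2 in e1.
rewrite -(ler_pM2l tau0) e1.
move: et; rewrite ltr_pdivrMr// => et.
move: k1 k3 prC; rewrite !ler_norml => /andP[_ k1] /andP[_ k3] /andP[k4 _].
exact: (limit_estimate h0 a0 k1 k3 k4 et).
Qed.

Lemma bochner_limit (C : R[i]) A (G : R -> X -> R[i]) : 0 <= A -> A1 <= A ->
  (forall c, null_average mu A (fun s x => Fc c s x - cpart c C)) ->
  (forall tau, is_bochner_integral mu (window A1 tau) F (G tau)) ->
  cLnorm mu 2%:E (fun x => ((tau^-1)%:C)%C * G tau x - C) @[tau --> +oo] --> 0%E.
Proof.
move=> A0 A1A av hG.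
have key c e (e0 : 0 < e) := bochner_limit_part A0 A1A (av c) hG e0.
have E tau c x : cpart c (((tau^-1)%:C)%C * G tau x - C) = tau^-1 * cpart c (G tau x) - cpart c C.
  by rewrite cpartB cpartZ.
have L tau c : L2 (fun x => cpart c (((tau^-1)%:C)%C * G tau x - C)).
  under [X in L2 X]eq_fun do rewrite E.
  have [_ /in_Lp2P GL2 _] := hG tau.
  by apply: L2B; [exact: L2Z|exact: L2_cst].
rewrite (_ : (fun tau => _) = fun tau => (cn (fun x => ((tau^-1)%:C)%C * G tau x - C))%:E); last first.
  by apply/funext => tau; exact: cLnorm2E.
apply: cvg_EFin; first exact: nearW.
apply/cvgr0Pnorm_le => e e0; have e2 : 0 < e / 2 by rewrite divr_gt0.
have [S1 [_ h1]] := key true _ e2; have [S2 [_ h2]] := key false _ e2.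
exists (Num.max S1 S2); split; first exact: num_real.
move=> tau; rewrite gt_max => /andP[t1 t2] /=.
rewrite ger0_norm ?cn_ge0//; apply: le_trans (cn_le _ _) _; rewrite [leRHS](splitr e).
have [_ n1] := h1 _ t1; have [_ n2] := h2 _ t2.
by apply: lerD; [apply: le_trans n1|apply: le_trans n2]; rewrite le_eqVlt;
  apply/orP; left; apply/eqP; apply: nrm_eq => x; rewrite E.
Qed.

End BochnerLimit.

(** * Existence of the Bochner integral *)

Section BochnerExists.
Context d (X : measurableType d) (R : realType) (mu : probability X R).
Local Notation nrm := (l2norm mu).
Local Notation L2 := (L2 mu).
Local Notation pr := (pairing mu).
Local Notation cn := (cl2norm mu).
Local Notation leb := (@lebesgue_measure R).
Variables (A1 : R) (F : R -> X -> R[i]) (Fc : bool -> R -> X -> R).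
Hypothesis hFm : forall s, cmeasurable (F s).
Hypothesis hFae : forall s, \forall x \ae mu, forall c, cpart c (F s x) = Fc c s x.
Hypothesis hgood : forall c, regular mu A1 (Fc c).
Variable tau : R.
Local Notation window := (window A1 tau).

Definition node (n m : nat) : R := m%:R * (tau / n.+1%:R).

Definition cell n m : set R := [set s | node n m < s <= node n m.+1].

Lemma node_last n : node n n.+1 = tau.
Proof. by rewrite /node mulrCA divff ?mulr1// pnatr_eq0. Qed.

Lemma node_le n m m' : 0 <= tau -> (m <= m')%N -> node n m <= node n m'.
Proof. by move=> t0 mm; rewrite ler_wpM2r ?divr_ge0// ler_nat. Qed.

Lemma cell_exists n s : 0 < s <= tau -> exists m : 'I_n.+1, cell n m s.
Proof.
move=> /andP[s0 st].
have ex : exists m, s <= node n m by exists n.+1; rewrite node_last.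
case: (ex_minnP ex) => -[|m] hm hmin.
  by move: hm; rewrite /node mul0r leNgt s0.
have mn : (m < n.+1)%N by apply: hmin; rewrite node_last.
exists (Ordinal mn); rewrite /cell /= hm andbT ltNge; apply/negP => /hmin.
by rewrite ltnn.
Qed.

Lemma cell_unique n m m' s : 0 <= tau -> cell n m s -> cell n m' s -> m = m'.
Proof.
move=> t0; wlog mm : m m' / (m <= m')%N.
  move=> H h h'; have [mm|/ltnW mm] := leqP m m'; first exact: H.
  by apply/esym; exact: H.
rewrite /cell /= => /andP[_ h] /andP[h' _].
move: mm; rewrite leq_eqVlt => /predU1P[//|mm].
by have := lt_le_trans h' (le_trans h (node_le n t0 mm)); rewrite ltxx.
Qed.

Lemma cell_meas n m : measurable (window `&` cell n m).
Proof.
apply: measurableI; first exact: window_meas.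
rewrite (_ : cell n m = [set` `]node n m, node n m.+1]]); first exact: measurable_itv.
by apply/seteqP; split => s; rewrite /cell /= in_itv.
Qed.

Lemma cell_fin n m : (leb (window `&` cell n m) < +oo)%E.
Proof.
apply: le_lt_trans (window_fin A1 tau).
by apply: le_measure; rewrite ?inE; first [exact: cell_meas|exact: window_meas|exact: subIsetl].
Qed.

Definition step n : L2_simple mu := @L2Simple d X R mu n.+1
  (fun m => window `&` cell n m) (fun m => F (node n m.+1))
  (fun m => cell_meas n m) (fun m => cell_fin n m)
  (fun m => F_in_Lp hFm hFae hgood (node n m.+1)).

Lemma window_tau_ge0 s : window s -> 0 <= tau.
Proof. by case=> /andP[s0 st] _; exact: le_trans st. Qed.

(** The cells cover the positive times of the window, where exactly one indicator
    is 1; at the time 0, if it belongs to the window, the step function is 0. *)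
Lemma stepP n s : window s ->
  (exists m : 'I_n.+1, [/\ cell n m s,
     forall m' : 'I_n.+1, (\1_(window `&` cell n m') s : R) = (m' == m)%:R &
     forall x, simple_fun (step n) s x = F (node n m.+1) x]) \/
  ((forall m : 'I_n.+1, (\1_(window `&` cell n m) s : R) = 0) /\
   s <= 0 /\ forall x, simple_fun (step n) s x = 0).
Proof.
move=> Ds; have t0 := window_tau_ge0 Ds.
have [[m hm]|H] := pselect (exists m : 'I_n.+1, cell n m s).
  left; exists m.
  have ind (m' : 'I_n.+1) : (\1_(window `&` cell n m') s : R) = (m' == m)%:R.
    rewrite indicE; have [->|mm] := eqVneq m' m; first by rewrite mem_set.
    rewrite memNset//= => -[_ h]; move/eqP: mm; apply.
    by apply/val_inj; exact: cell_unique t0 h hm.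
  split => // x; rewrite /simple_fun /= (bigD1 m)//= big1 => [|m' mm].
    by rewrite ind eqxx addr0 mul1r.
  by rewrite ind (negbTE mm) mul0r.
right.
have ind (m : 'I_n.+1) : (\1_(window `&` cell n m) s : R) = 0.
  by rewrite indicE memNset// => -[_ h]; apply: H; exists m.
split => //; split.
  rewrite leNgt; apply/negP => s0; apply: H; apply: cell_exists.
  by rewrite s0/=; case: Ds => /andP[].
by move=> x; rewrite /simple_fun big1// => m _; rewrite /= ind mul0r.
Qed.

Let dist (w : X -> R[i]) s := cn (fun x => F s x - w x).

Lemma F_dist_L2 w s c : (forall c, L2 (fun x => cpart c (w x))) ->
  L2 (fun x => cpart c (F s x - w x)).
Proof.
move=> hw; under [X in L2 X]eq_fun do rewrite cpartB.
by apply: L2B => //; exact: F_L2.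
Qed.

Lemma F_nrm_dist w s c : (forall c, L2 (fun x => cpart c (w x))) ->
  nrm (fun x => cpart c (F s x - w x)) = nrm (fun x => Fc c s x - cpart c (w x)).
Proof.
move=> hw; have [m1 _] := regular_L2 s (hgood c); have [m2 _] := hw c.
apply: nrm_ae; first by case: (F_dist_L2 s c hw).
- exact: measurable_funB.
- by apply: filterS (hFae s) => x hx; rewrite cpartB hx.
Qed.

Lemma regular_nrm_cont c g : L2 g -> cont_ray A1 (fun s => nrm (fun x => Fc c s x - g x)).
Proof.
move=> hg s As; apply/cvgrPdist_le => e e0.
have LF t := regular_L2 t (hgood c).
case: (hgood c) => _ /(_ s As e e0); apply: filterS => t; apply: le_trans.
have d1 := nrm_dist3 (LF s) (LF t) hg; have d2 := nrm_dist3 (LF t) (LF s) hg.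
have sw : nrm (fun x => Fc c s x - Fc c t x) = nrm (fun x => Fc c t x - Fc c s x).
  exact: nrmBC.
rewrite sw in d1.
by rewrite ler_norml; apply/andP; split; lra.
Qed.

Lemma dist_cont w : (forall c, L2 (fun x => cpart c (w x))) -> cont_ray A1 (dist w).
Proof.
move=> hw s As.
pose n1 s := nrm (fun x => Fc true s x - cpart true (w x)).
pose n2 s := nrm (fun x => Fc false s x - cpart false (w x)).
have c1 : {for s, continuous n1} := regular_nrm_cont (hw true) As.
have c2 : {for s, continuous n2} := regular_nrm_cont (hw false) As.
have -> : dist w = (@Num.sqrt R) \o (fun s => n1 s * n1 s + n2 s * n2 s).
  by apply/funext => t /=; rewrite /dist /cl2norm !F_nrm_dist// -!expr2.
apply: continuous_comp; last exact: sqrt_continuous.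
by apply: continuousD; exact: continuousM.
Qed.

Lemma step_error n s : simple_error F (step n) s = (cn (fun x => F s x - simple_fun (step n) s x))%:E.
Proof. exact: (simple_errorE hFm hFae hgood). Qed.

Lemma zero_L2 c : L2 (fun x : X => cpart c 0).
Proof. exact: L2_cst. Qed.

Lemma F_cpart_L2 n (m : nat) c : L2 (fun x => cpart c (F (node n m) x)).
Proof. exact: (F_L2 hFm hFae hgood). Qed.

(** The error is a combination of indicators of cells with the distances from F to
    fixed elements of L2, which are continuous in time. *)
Lemma step_error_meas n : measurable_fun window (simple_error F (step n)).
Proof.
pose ind (m : 'I_n.+1) : R -> R := \1_(window `&` cell n m).
have mind m : measurable_fun window (ind m).
  by apply: measurable_indic; exact: cell_meas.
pose E s := \sum_(m < n.+1) ind m s * dist (F (node n m.+1)) s +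
  (1 - \sum_(m < n.+1) ind m s) * dist (fun=> 0) s.
apply: (@eq_measurable_fun _ _ _ _ window (EFin \o E)).
  move=> s; rewrite inE => Ds; rewrite step_error /=; congr EFin; rewrite /E.
  have [[m [_ hind hs]]|[hind [_ hs]]] := stepP n Ds.
    rewrite (bigD1 m)//= big1 => [|m' mm]; last by rewrite /ind hind (negbTE mm) mul0r.
    rewrite (bigD1 m)//= big1 => [|m' mm]; last by rewrite /ind hind (negbTE mm).
    rewrite /ind hind eqxx mul1r !addr0 subrr mul0r addr0 /dist; congr cl2norm.
    by apply/funext => x; rewrite hs.
  rewrite big1 => [|m' _]; last by rewrite /ind hind mul0r.
  rewrite big1 => [|m' _]; last by rewrite /ind hind.
  rewrite add0r subr0 mul1r /dist; congr cl2norm.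
  by apply/funext => x; rewrite hs.
apply/measurable_EFinP; apply: measurable_funD.
  apply: measurable_sum => m; apply: measurable_funM => //.
  by apply: ray_window_meas; apply: dist_cont => c; exact: F_cpart_L2.
apply: measurable_funM; last by apply: ray_window_meas; apply: dist_cont => c; exact: zero_L2.
apply: measurable_funB => //; exact: measurable_sum.
Qed.

Lemma step_error_bound : exists B : R, forall n s, window s ->
  (simple_error F (step n) s <= B%:E)%E.
Proof.
have [[N1 h1] _] := hgood true; have [[N2 h2] _] := hgood false.
pose N := N1 + N2.
have P1 : 0 <= N1 := bdd_ge0 (h1 0); have P2 : 0 <= N2 := bdd_ge0 (h2 0).
have nF c s : nrm (fun x => cpart c (F s x)) <= N.
  have -> : nrm (fun x => cpart c (F s x)) = nrm (Fc c s).
    apply: nrm_ae; first exact: F_meas.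
      by case: (regular_L2 s (hgood c)).
    by apply: filterS (hFae s) => x ->.
  by case: c; [apply: le_trans (nrm_bdd mu (h1 s)) _|apply: le_trans (nrm_bdd mu (h2 s)) _];
    rewrite /N; lra.
exists (N + N + (N + N)) => n s Ds; rewrite step_error lee_fin.
have N0 : 0 <= N by rewrite addr_ge0.
have key c : nrm (fun x => cpart c (F s x - simple_fun (step n) s x)) <= N + N.
  rewrite (nrm_eq mu (g := fun x => cpart c (F s x) - cpart c (simple_fun (step n) s x))); last first.
    by move=> x; rewrite cpartB.
  apply: le_trans (nrmB (F_L2 hFm hFae hgood c s) (simple_fun_L2 _ _ _)) _.
  apply: lerD => //.
  have [[m [_ _ hs]]|[_ [_ hs]]] := stepP n Ds.
    by rewrite (nrm_eq mu (g := fun x => cpart c (F (node n m.+1) x)))// => x; rewrite hs.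
  rewrite (nrm_eq mu (g := fun=> 0)) => [|x]; last by rewrite hs cpart0.
  by rewrite /l2norm expr0n/= intC sqrtr0.
by apply: le_trans (cn_le _ _) (lerD (key true) (key false)).
Qed.

Lemma step_error_cvg s : window s -> 0 < s -> simple_error F (step n) s @[n --> \oo] --> 0%E.
Proof.
move=> Ds s0; have t0 := window_tau_ge0 Ds.
rewrite (_ : (fun n => _) = fun n => (cn (fun x => F s x - simple_fun (step n) s x))%:E); last first.
  by apply/funext => n; exact: step_error.
apply: cvg_EFin; first exact: nearW.
apply/cvgr0Pnorm_le => e e0; have e2 : 0 < e / 2 by rewrite divr_gt0.
have As : A1 < s by case: Ds.
have [_ /(_ s As _ e2) n1] := hgood true; have [_ /(_ s As _ e2) n2] := hgood false.
have : \forall t \near s, nrm (fun x => Fc true t x - Fc true s x) <= e / 2 /\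
    nrm (fun x => Fc false t x - Fc false s x) <= e / 2 by exact: filterS2 n1 n2.
move=> /nbhs_ballP[delta /= d0 hd].
exists (Num.truncn (tau / delta)) => // n /= hn.
rewrite ger0_norm ?cn_ge0//.
have small : tau / n.+1%:R < delta.
  rewrite ltr_pdivrMr// mulrC -ltr_pdivrMr//.
  by apply: lt_le_trans (truncnS_gt _) _; rewrite ler_nat ltnS.
have [[m [/andP[c1 c2] _ hs]]|[_ [s0' _]]] := stepP n Ds; last by move: s0'; rewrite leNgt s0.
have [] := hd (node n m.+1).
  rewrite -ball_normE /= distrC ger0_norm ?subr_ge0//.
  apply: lt_trans small; rewrite ltrBlDl.
  rewrite [ltLHS](_ : _ = node n m + tau / n.+1%:R); first by rewrite ltrD2r.
  by rewrite /node -natr1 mulrDl mul1r.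
move=> k1 k2; apply: le_trans (cn_le _ _) _; rewrite [leRHS](splitr e).
have err_node c : nrm (fun x => cpart c (F s x - simple_fun (step n) s x)) =
    nrm (fun x => Fc c (node n m.+1) x - Fc c s x).
  rewrite (nrm_eq mu (g := fun x => cpart c (F s x - F (node n m.+1) x))); last first.
    by move=> x; rewrite hs.
  rewrite F_nrm_dist; last by move=> c'; exact: F_cpart_L2.
  rewrite nrmBC; have [m1 _] := regular_L2 s (hgood c).
  apply: nrm_ae.
  - by apply: measurable_funB => //; exact: F_meas.
  - by apply: measurable_funB => //; case: (regular_L2 (node n m.+1) (hgood c)).
  - by apply: filterS (hFae (node n m.+1)) => x ->.
by rewrite !err_node lerD.
Qed.

(** Dominated convergence; the time 0, which lies in no cell, is a null set. *)
Lemma step_error_int_cvg :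
  (\int[leb]_(s in window) simple_error F (step n) s)%E @[n --> \oo] --> 0%E.
Proof.
have [B hB] := step_error_bound.
have mD := window_meas A1 tau.
have [||||_ _] := @dominated_convergence _ _ R leb window mD
  (fun n => simple_error F (step n)) (cst 0%E) (cst B%:E) step_error_meas.
- exact: measurable_cst.
- exists [set 0]; split; [exact: measurable_set1|exact: lebesgue_measure_set1|].
  move=> s /= h; apply: contrapT => s0; apply: h => Ds; apply: step_error_cvg => //.
  by rewrite lt_neqAle eq_sym; case: (Ds) => /andP[-> _] _; rewrite andbT; apply/eqP.
- apply: (@ray_window_int _ A1 tau (fun=> B) `|B|) => //.
  by move=> s _; exact: cvg_cst.
- apply: aeW => s n Ds; rewrite gee0_abs; first exact: hB.
  by rewrite step_error lee_fin cn_ge0.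
by rewrite integral0.
Qed.

(** By [simple_pairing] the difference of the integrals of two step functions,
    tested against itself, has norm at most the sum of their errors; the limit in
    L2 of these integrals is the required function. *)
Lemma bochner_exists : exists G, is_bochner_integral mu window F G.
Proof.
pose I n := simple_integral window (step n).
have LI n c : L2 (fun x => cpart c (I n x)) by exact: simple_integral_L2.
have cauchy c e : 0 < e -> exists N, forall n m, (N <= n)%N -> (N <= m)%N ->
    nrm (fun x => cpart c (I n x) - cpart c (I m x)) <= e.
  move=> e0; have e2 : 0 < e / 2 by rewrite divr_gt0.
  have [N _ hN] := cvge0_near_lt step_error_int_cvg e2.
  exists N => n m Nn Nm; pose h x := cpart c (I n x) - cpart c (I m x).
  have hh : L2 h by exact: L2B.
  apply: nrm_le_pr; first exact: ltW.
  have key j : (N <= j)%N -> `|pr (fun x => cpart c (I j x)) h -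
      \int[leb]_(s in window) pr (Fc c s) h| <= e / 2 * nrm h.
    move=> Nj; rewrite -lee_fin.
    apply: le_trans (simple_pairing hFm hFae hgood c hh (step_error_meas j)) _.
    by rewrite EFinM muleC lee_wpmul2r ?lee_fin ?nrm_ge0// ltW//; exact: hN.
  rewrite -/h -pairing_self {1}/h pairingB//.
  have := lerD (key n Nn) (key m Nm); rewrite -mulrDl -splitr.
  apply: le_trans; apply: le_trans (ler_normB _ _).
  by rewrite opprB addrA subrK ler_norm.
have lim c := L2_complete (fun n => LI n c) (cauchy c).
have [wR [LR hR]] := lim true; have [wI [LIm hI]] := lim false.
pose G x := Complex (wR x) (wI x).
have LG c : L2 (fun x => cpart c (G x)) by case: c; [exact: LR|exact: LIm].
exists G; split.
- by move=> s _; exact: (F_in_Lp hFm hFae hgood).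
- exact/in_Lp2P.
exists step; split; [exact: step_error_meas|exact: step_error_int_cvg|].
have LGI n c : L2 (fun x => cpart c (G x - I n x)).
  by under [X in L2 X]eq_fun do rewrite cpartB; exact: L2B.
rewrite (_ : (fun n => _) = fun n => (cn (fun x => G x - I n x))%:E); last first.
  by apply/funext => n; exact: (cLnorm2E (LGI n)).
apply: cvg_EFin; first exact: nearW.
apply/cvgr0Pnorm_le => e e0; have e2 : 0 < e / 2 by rewrite divr_gt0.
have [N1 h1] := hR _ e2; have [N2 h2] := hI _ e2.
exists (maxn N1 N2) => // n /=; rewrite geq_max => /andP[Nn1 Nn2].
rewrite ger0_norm ?cn_ge0//; apply: le_trans (cn_le _ _) _; rewrite [leRHS](splitr e).
apply: lerD.
  rewrite (nrm_eq mu (g := fun x => wR x - cpart true (I n x))) => [|x]; last by rewrite cpartB.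
  by rewrite nrmBC; exact: h1.
rewrite (nrm_eq mu (g := fun x => wI x - cpart false (I n x))) => [|x]; last by rewrite cpartB.
by rewrite nrmBC; exact: h2.
Qed.

End BochnerExists.

(** * Joint averages *)

Lemma max_endpoint (R : realType) (k l : nat) (b : 'I_k -> 'I_l -> R) :
  (0 < k)%N -> (0 < l)%N ->
  exists i0 j0, forall i j, b i j <= b i0 j0.
Proof.
move=> hk hl.
have [[i0 j0] _ h] := @arg_maxP _ R ('I_k * 'I_l)%type (Ordinal hk, Ordinal hl) predT
  (fun ij => b ij.1 ij.2) isT.
by exists i0, j0 => i j; exact: (h (i, j)).
Qed.

Theorem theorem5p9 (R : realType) (d : measure_display) (X : measurableType d)
  (mu : probability X R) (k l : nat) (hk : (0 < k)%N) (hl : (0 < l)%N)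
  (T : 'I_k -> 'I_l -> R -> X -> X)
  (b : 'I_k -> 'I_l -> R) (p : 'I_k -> 'I_l -> R -> R)
  (hT : forall i j, measure_preserving_action mu (T i j))
  (hTcont : forall i j, continuous_action mu (T i j))
  (hTerg : forall i j, ergodic_action mu (T i j))
  (hp : forall i j, admissible (b i j) (p i j))
  (hcomm : forall i i' j j' s s',
     T i j s \o T i' j' s' = T i' j' s' \o T i j s)
  (hgrowth : forall (i i' : 'I_k) (j j' : 'I_l),
     (i' < i)%N \/ (i = i' /\ (j' < j)%N) ->
     p i j s / p i' j' s @[s --> +oo] --> (0 : R))
  (f : 'I_k -> X -> R[i]) (hf : forall i, in_Lp mu +oo%E (f i)) :
  (forall tau : R, exists G : X -> R[i],
     is_bochner_integral mu (admissible_times b tau) (integrand T p f) G) /\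
  (forall G : R -> X -> R[i],
     (forall tau : R,
        is_bochner_integral mu (admissible_times b tau) (integrand T p f) (G tau)) ->
     cLnorm mu 2%:E (fun x => ((tau^-1)%:C)%C * G tau x
                              - \prod_(i < k) cintegral mu (f i))
       @[tau --> +oo] --> 0%E).
Proof.
have [i0 [j0 bmax]] := max_endpoint b hk hl.
pose A1 := b i0 j0.
have windowE tau : admissible_times b tau = window A1 tau.
  apply/seteqP; split => s [h1 h2]; split => //; first exact: h2.
  by move=> i j; exact: le_lt_trans (bmax i j) h2.
have [M [v [M1 hv fv]]] := bounded_parts hf.
have hFm := integrand_cmeasurable hT p hf.
have hFae := integrand_ae hT p fv.
have hg c := integrand_part_regular hT M1 hv hTcont hcomm hp c bmax.
split=> [tau|G hG]; first by rewrite windowE; exact: (bochner_exists hFm hFae hg).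
have A0 : 0 <= Num.max A1 0 by rewrite le_max lexx orbT.
have A1A : A1 <= Num.max A1 0 by rewrite le_max lexx.
have bA i j : b i j <= Num.max A1 0 by exact: le_trans (bmax i j) A1A.
apply: (bochner_limit hFm hFae hg A0 A1A) => [c|tau]; last by rewrite -windowE.
exact: (integrand_part_average hT hf M1 hv fv hTcont hcomm hp (fun i j B => @hTerg i j B) hgrowth hl c A0 bA).
Qed.
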